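(* For each integer $n\ge 1$, let $\xi_n$ be the number of block pairs of a uniformly random $B_n$-partition. Then the limiting distribution of $\xi_n$ is normal; that is, the random variable $$\frac{\xi_n-\mathrm{E}(\xi_n)}{\sqrt{\mathrm{V}(\xi_n)}}$$ converges in distribution to the standard normal distribution as $n\to\infty$, where $\mathrm{E}(\xi_n)$ and $\mathrm{V}(\xi_n)$ denote the expectation and the variance of $\xi_n$.
   Context: A type $B_n$ set partition ($B_n$-partition) is a partition $\pi$ of the set $\{1,2,\ldots,n,-1,-2,\ldots,-n\}$ into nonempty blocks such that for any block $B$ of $\pi$, the set $-B=\{-b: b\in B\}$ is also a block of $\pi$, and there is at most one block, called the zero-block, satisfying $B=-B$. If $B$ is a block that is not a zero-block, then the (unordered) pair $(B,-B)$ is called a block pair of $\pi$. The number of block pairs of $\pi$ is thus half the number of non-zero blocks. *)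

(* Defs.v *)
From HB Require Import structures.
From mathcomp Require Import all_boot all_order all_algebra.
Set Implicit Arguments.
Unset Strict Implicit.
Unset Printing Implicit Defensive.

(* (i, false) encodes the integer i + 1 and (i, true) encodes -(i + 1), so that
   this is the set {1, ..., n, -1, ..., -n}. *)
Definition signed (n : nat) : finType := ('I_n * bool)%type.

Definition sneg n (x : signed n) : signed n := (x.1, ~~ x.2).

Definition bneg n (B : {set signed n}) : {set signed n} :=
  [set sneg b | b in B].

Definition is_bnpart n (P : {set {set signed n}}) : bool :=
  [&& partition P [set: signed n],
      [forall B in P, bneg B \in P] &
      #|[set B in P | bneg B == B]| <= 1].

Record bnpart n :=
  BnPart { bnpart_val :> {set {set signed n}}; _ : is_bnpart bnpart_val }.

HB.instance Definition _ n := [isSub for @bnpart_val n].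
HB.instance Definition _ n := [Finite of bnpart n by <:].

(* A block pair is the unordered pair {B, -B}, encoded as a set of blocks. *)
Definition block_pairs n (p : bnpart n) : {set {set {set signed n}}} :=
  [set [set B; bneg B] | B in bnpart_val p & bneg B != B].

Lemma is_bnpart_singletons n :
  is_bnpart [set [set x] | x in [set: signed n]].
Proof.
have negE (x : signed n) : bneg [set x] = [set sneg x].
  exact: imset_set1.
apply/and3P; split.
- apply/and3P; split.
  + apply/eqP/setP => x; rewrite inE; apply/bigcupP.
    by exists [set x]; rewrite ?set11// imset_f.
  + apply/trivIsetP => _ _ /imsetP[x _ ->] /imsetP[y _ ->] xy.
    by rewrite disjoints1 inE; apply: contraNneq xy => ->.
  + by apply/imsetP => -[x _] /setP/(_ x); rewrite !inE eqxx.
- apply/forall_inP => _ /imsetP[x _ ->].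
  by rewrite negE imset_f.
- suff -> : [set B in [set [set x] | x in [set: signed n]] | bneg B == B] = set0
    by rewrite cards0.
  apply/setP => B; rewrite !inE; apply/andP => -[/imsetP[[i b] _ ->]].
  rewrite negE => /eqP/set1_inj/(congr1 snd)/=.
  by case: b.
Qed.

From mathcomp Require Import all_classical all_reals all_analysis.
From mathcomp Require Import measurable_realfun.
Import Order.TTheory GRing.Theory Num.Theory.
Import numFieldNormedType.Exports.
Local Open Scope classical_set_scope.
Local Open Scope ring_scope.

HB.instance Definition _ n :=
  isPointed.Build (bnpart n) (BnPart (is_bnpart_singletons n)).

HB.instance Definition _ n :=
  @isMeasurable.Build default_measure_display (bnpart n) discrete_measurable
    discrete_measurable0 discrete_measurableC discrete_measurableU.

Definition uniform_bnpart (R : realType) n (A : set (bnpart n)) : \bar R :=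
  (#|[pred p : bnpart n | p \in A]|%:R / #|{: bnpart n}|%:R)%:E.

Section uniform_bnpart_probability.
Context (R : realType) (n : nat).
Local Notation U := (@uniform_bnpart R n).

Let c_ge0 : (0 : R) <= #|{: bnpart n}|%:R^-1.
Proof. by rewrite invr_ge0. Qed.

Lemma uniform_bnpartE : U = mscale (NngNum c_ge0) (@counting (bnpart n) R).
Proof.
apply/funext => A; have finA : finite_set A by exact: finite_finset.
rewrite /mscale /= /counting; case: asboolP => // _.
rewrite /uniform_bnpart -EFinM.
suff -> : #|[pred p : bnpart n | p \in A]| =
  size (finmap.enum_fset (fset_set A)) by rewrite mulrC.
rewrite cardE; apply: perm_size; apply: uniq_perm.
- exact: enum_uniq.
- exact: finmap.fset_uniq.
- by move=> p; rewrite mem_enum inE [RHS]in_fset_set.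
Qed.

Let U0 : U set0 = 0%E.
Proof. by rewrite uniform_bnpartE measure0. Qed.

Let U_ge0 A : (0 <= U A)%E.
Proof. by rewrite uniform_bnpartE measure_ge0. Qed.

Let U_sigma_additive : semi_sigma_additive U.
Proof. by rewrite uniform_bnpartE; exact: measure_semi_sigma_additive. Qed.

HB.instance Definition _ := isMeasure.Build _ _ _ U U0 U_ge0 U_sigma_additive.

Let U_setT : U [set: bnpart n] = 1%E.
Proof.
rewrite /uniform_bnpart (@eq_card _ _ predT) => [|p]; last first.
  by rewrite inE [LHS]mem_set.
rewrite divff// pnatr_eq0 -lt0n.
by apply/card_gt0P; exists point.
Qed.

HB.instance Definition _ := Measure_isProbability.Build _ _ _ U U_setT.

End uniform_bnpart_probability.

Definition num_block_pairs (R : realType) n (p : bnpart n) : R :=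
  #|block_pairs p|%:R.

Lemma measurable_num_block_pairs (R : realType) n :
  measurable_fun [set: bnpart n] (@num_block_pairs R n).
Proof. by []. Qed.

HB.instance Definition _ (R : realType) n :=
  isMeasurableFun.Build _ _ _ _ (@num_block_pairs R n)
    (@measurable_num_block_pairs R n).

Definition xi (R : realType) n : {RV (@uniform_bnpart R n) >-> R} :=
  @num_block_pairs R n.

Section standardize.
Context d (T : measurableType d) (R : realType) (P : probability T R).

Definition standardized (X : {RV P >-> R}) (w : T) : R :=
  (X w - fine 'E_P[X]) / Num.sqrt (fine 'V_P[X]).

Lemma measurable_standardized (X : {RV P >-> R}) :
  measurable_fun [set: T] (standardized X).
Proof. by apply: measurable_funM => //; apply: measurable_funB. Qed.

HB.instance Definition _ (X : {RV P >-> R}) :=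
  isMeasurableFun.Build _ _ _ _ (standardized X) (measurable_standardized X).

Definition standardize (X : {RV P >-> R}) : {RV P >-> R} := standardized X.

End standardize.

(* The variables may live on different probability spaces; the distribution
   functions are required to converge at the continuity points of the limit. *)
Definition cvg_in_distribution (R : realType) (d : nat -> measure_display)
    (T : forall n, measurableType (d n)) (P : forall n, probability (T n) R)
    (X : forall n, {RV (P n) >-> R})
    (mu : probability (measurableTypeR R) R) : Prop :=
  forall x : R, {for x, continuous (fun y : R => mu `]-oo, y]%classic)} ->
    cdf (X n) x @[n --> \oo] --> mu `]-oo, x]%classic.

(* Main.v *)
Require Import Defs.
From mathcomp Require Import all_boot.
Set Implicit Arguments.
Unset Strict Implicit.
Unset Printing Implicit Defensive.

(** Write k(p) for the number of block pairs of a B_n-partition p. An odd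
    function from {1, .., n, -1, .., -n} to {-y, .., y} is the same as the
    B_n-partition formed by its fibres, together with a sign and an absolute
    value for each block pair, the absolute values being distinct. Hence
      (2 y + 1)^n = sum_p 2^k(p) y (y - 1) .. (y - k(p) + 1)
    (odd_power_sum). Divided by 2^y y!, this identity says that the weights
    wt n y = (2 y + 1)^n / (2^y y!) are, up to a constant factor, the law of
    xi_n + Z, where Z is a Poisson variable of mean 1/2 that is independent of
    xi_n (wt_mixture, mixture_sum). As Z does not depend on n while the variance
    of xi_n tends to infinity, xi_n and xi_n + Z have the same normal limit, and
    the law of the latter is explicit enough for the Laplace method.

    The weights are log-concave, and the second difference of ln (wt n) at y is
    - (n / y^2 + 1 / y), up to a factor that tends to 1 (dlwt_ub, dlwt_lb). Let m
    be the mode of the weights and let s be the inverse square root of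
    n / m^2 + 1 / m. Then n^2 <= 8 (m + 2)^3 (mode_large), so that m and s tend
    to infinity, while s^2 <= m. The second difference is therefore nearly
    constant on windows of width O(s) around m. This gives
      wt n (m + u s) / wt n m -> exp (- u^2 / 2)
    for bounded u (lwt_quadratic), and concavity gives the bound
    exp (2 - |u| / 2) for all u as soon as n is large (lwt_tail). If the sums over y are read as
    integrals of step functions, dominated convergence yields the limits of all
    sums of wt n y * g ((y - m) / s) where g has quadratic growth
    (laplace_integral).

    With g = 1, u^2, (u + 1)^2 one finds that the mean of xi_n is m + o(s) and
    that its variance is asymptotic to s^2 (qmean_cvg0, var_scale_cvg). With g the
    indicator of a half line one finds the distribution function of xi_n + Z, and
      P(xi_n + Z <= a) <= P(xi_n <= a) <= P(xi_n + Z <= a + J) / P(Z < J)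
    transfers it to xi_n, since the shift by J disappears after division by s
    (cdf_count_cvg). *)

(** * Odd functions and their kernels *)

Section Blocks.
Variable n : nat.
Implicit Types (x z : signed n) (B : {set signed n}) (p : bnpart n).

Lemma snegK : involutive (@sneg n).
Proof. by case=> i b; rewrite /sneg /= negbK. Qed.

Lemma mem_bneg B x : (sneg x \in bneg B) = (x \in B).
Proof. by rewrite mem_imset //; exact: inv_inj snegK. Qed.

Lemma bnegK : involutive (@bneg n).
Proof.
move=> B; rewrite /bneg -imset_comp -[RHS]imset_id.
by apply: eq_imset => x /=; rewrite snegK.
Qed.

Variable p : bnpart n.

Lemma bnpart_partition : partition p [set: signed n].
Proof. by case: p => P /= /and3P[]. Qed.

Lemma bneg_block B : B \in bnpart_val p -> bneg B \in bnpart_val p.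
Proof. by case: p => P /= /and3P[_ /forall_inP h _]; exact: h. Qed.

Lemma zero_block_uniq B B' : B \in bnpart_val p -> B' \in bnpart_val p ->
  bneg B = B -> bneg B' = B' -> B = B'.
Proof.
case: p => P /= /and3P[_ _ /card_le1_eqP h] BP B'P zB zB'.
by apply: h; rewrite inE ?BP ?B'P ?zB ?zB' eqxx.
Qed.

Definition blk x := pblock p x.

Lemma blk_in x : blk x \in bnpart_val p.
Proof.
by apply: pblock_mem; case/and3P: bnpart_partition => /eqP ->; rewrite inE.
Qed.

Lemma mem_blk x : x \in blk x.
Proof. by rewrite mem_pblock; case/and3P: bnpart_partition => /eqP ->; rewrite inE. Qed.

Lemma blk_def B x : B \in bnpart_val p -> x \in B -> blk x = B.
Proof. by move=> BP xB; apply: def_pblock => //; case/and3P: bnpart_partition. Qed.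

Lemma blk_sneg x : blk (sneg x) = bneg (blk x).
Proof. by apply: blk_def; rewrite ?bneg_block ?blk_in// mem_bneg mem_blk. Qed.

Definition pair_of x := [set blk x; bneg (blk x)].

Lemma pair_of_sneg x : pair_of (sneg x) = pair_of x.
Proof. by rewrite /pair_of blk_sneg bnegK setUC. Qed.

Lemma pair_ofP x : (pair_of x \in block_pairs p) = (bneg (blk x) != blk x).
Proof.
apply/idP/idP => [/imsetP[B]|h].
  rewrite inE => /andP[_ nB] e; apply: contra nB => /eqP zb.
  have : B \in pair_of x by rewrite e set21.
  by rewrite !inE zb orbb => /eqP ->; apply/eqP.
by apply/imsetP; exists (blk x); rewrite ?inE ?blk_in.
Qed.

Lemma block_pairsP q : q \in block_pairs p ->
  exists x, [/\ q = pair_of x & bneg (blk x) != blk x].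
Proof.
case/imsetP => B; rewrite inE => /andP[BP nB] ->.
have [x xB] : exists x, x \in B.
  apply/set0Pn; apply: contraTneq BP => ->.
  by case/and3P: bnpart_partition.
by exists x; rewrite /pair_of (blk_def BP xB).
Qed.

(** The sign of the label of a pair {B, -B} refers to this block. *)
Definition rep (q : {set {set signed n}}) : {set signed n} :=
  odflt set0 [pick B in q].

Lemma rep_in x : rep (pair_of x) \in pair_of x.
Proof.
rewrite /rep; case: pickP => [//|/(_ (blk x))].
by rewrite set21.
Qed.

Lemma rep_ex q : q \in block_pairs p ->
  exists x, [/\ pair_of x = q, blk x = rep q & bneg (blk x) != blk x].
Proof.
case/block_pairsP => x [-> nz]; have := rep_in x.
rewrite !inE => /orP[] /eqP e.
  by exists x.
by exists (sneg x); rewrite pair_of_sneg e blk_sneg bnegK eq_sym.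
Qed.

End Blocks.

Section Kernel.
Variables n y : nat.
Implicit Types (f : {ffun 'I_n -> option (signed y)}).

Definition odd_ext f (x : signed n) : option (signed y) :=
  if x.2 then omap (@sneg y) (f x.1) else f x.1.

Lemma odd_ext_sneg f x : odd_ext f (sneg x) = omap (@sneg y) (odd_ext f x).
Proof.
case: x => i [] //=; rewrite /odd_ext /=; case: (f i) => //= v.
by rewrite snegK.
Qed.

Lemma odd_ext_inj f f' : odd_ext f =1 odd_ext f' -> f = f'.
Proof. by move=> e; apply/ffunP => i; have := e (i, false). Qed.

Definition kernel f := preim_partition (odd_ext f) [set: signed n].

Lemma kernel_pblock f x :
  pblock (kernel f) x = [set z | odd_ext f z == odd_ext f x].
Proof.
apply/setP => z; rewrite inE /kernel /preim_partition.
rewrite pblock_equivalence_partition ?inE// 1?eq_sym//.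
by split=> // /eqP ->.
Qed.

Lemma sneg_neq (v : signed y) : sneg v != v.
Proof. by case: v => i []; apply/eqP. Qed.

(** A block B = -B can only be the fibre of None, because sneg has no fixed
    point: this is why there is at most one. *)
Lemma is_bnpart_kernel f : is_bnpart (kernel f).
Proof.
have Pk : partition (kernel f) [set: signed n] by exact: preim_partitionP.
have [/eqP cov tI n0] := and3P Pk.
have blE B : B \in kernel f -> exists x, B = [set z | odd_ext f z == odd_ext f x].
  move=> BP; have [x xB] : exists x, x \in B.
    by apply/set0Pn; apply: contraTneq BP => ->.
  by exists x; rewrite -kernel_pblock (def_pblock tI BP xB).
have inK x : [set z | odd_ext f z == odd_ext f x] \in kernel f.
  by rewrite -kernel_pblock pblock_mem// cov inE.
have negE x : bneg [set z | odd_ext f z == odd_ext f x]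
              = [set z | odd_ext f z == odd_ext f (sneg x)].
  apply/setP => z; rewrite -[z]snegK mem_bneg !inE !odd_ext_sneg.
  have oK : involutive (omap (@sneg y)) by case=> //= v; rewrite snegK.
  by rewrite (inj_eq (inv_inj oK)).
apply/and3P; split=> //.
  apply/forall_inP => B /blE[x ->].
  by rewrite negE inK.
apply/card_le1_eqP => B B'; rewrite !inE => /andP[/blE[x ->]].
rewrite negE => /eqP/setP/(_ x); rewrite !inE eqxx odd_ext_sneg => zx.
case/andP => /blE[x' ->].
rewrite negE => /eqP/setP/(_ x'); rewrite !inE eqxx odd_ext_sneg => zx'.
have -> : odd_ext f x = None.
  move: zx; case: (odd_ext f x) => //= v.
  by rewrite (inj_eq Some_inj) eq_sym (negbTE (sneg_neq v)).
suff -> : odd_ext f x' = None by [].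
move: zx'; case: (odd_ext f x') => //= v.
by rewrite (inj_eq Some_inj) eq_sym (negbTE (sneg_neq v)).
Qed.

Definition kernel_bnpart f : bnpart n := BnPart (is_bnpart_kernel f).

Lemma kernel_bnpartP f p :
  reflect (forall x z, (odd_ext f x == odd_ext f z) = (blk p x == blk p z))
          (kernel_bnpart f == p).
Proof.
apply: (iffP eqP) => [<- x z|h].
  rewrite /blk /= !kernel_pblock; apply/eqP/eqP => [->//|/setP/(_ x)].
  by rewrite !inE eqxx => /esym/eqP.
apply: val_inj => /=; rewrite -(equivalence_partition_pblock (bnpart_partition p)).
rewrite /kernel /preim_partition /equivalence_partition.
apply: eq_imset => x; apply/setP => z; rewrite !inE /=.
rewrite h -/(blk p x); apply/eqP/idP => [->|zx]; first exact: mem_blk.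
by apply/esym/blk_def => //; exact: blk_in.
Qed.

Section Fiber.
Variable p : bnpart n.

Let pairT := {q | q \in block_pairs p}.
Let mkpair q (h : q \in block_pairs p) : pairT := exist _ q h.

Definition labels := ({ffun pairT -> 'I_y} * {ffun pairT -> bool})%type.

(** The chosen block of a pair gets the label of the pair, the opposite block
    gets the opposite label, and the zero-block gets None. *)
Definition label_val (ab : labels) (x : signed n) : option (signed y) :=
  omap (fun q : pairT =>
    (ab.1 q, ab.2 q (+) (blk p x != rep (val q)))) (insub (pair_of p x)).

Definition of_labels (ab : labels) : {ffun 'I_n -> option (signed y)} :=
  [ffun i => label_val ab (i, false)].

Lemma label_valP ab x (q : pairT) : val q = pair_of p x ->
  label_val ab x = Some (ab.1 q, ab.2 q (+) (blk p x != rep (val q))).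
Proof. by move=> e; rewrite /label_val -e valK. Qed.

Lemma label_val_zero ab x : bneg (blk p x) = blk p x -> label_val ab x = None.
Proof. by move=> e; rewrite /label_val insubF// pair_ofP e eqxx. Qed.

Lemma label_val_sneg ab x : label_val ab (sneg x) = omap (@sneg y) (label_val ab x).
Proof.
have [e|nz] := eqVneq (bneg (blk p x)) (blk p x).
  by rewrite !label_val_zero// blk_sneg !e.
have h : pair_of p x \in block_pairs p by rewrite pair_ofP.
pose q : pairT := mkpair h.
rewrite (@label_valP _ x q)// (@label_valP _ (sneg x) q) ?pair_of_sneg//.
rewrite /sneg /= blk_sneg; congr (Some (_, _)).
have := rep_in p x; rewrite !inE => /orP[] /eqP ->; rewrite ?eqxx ?nz//=.
  by rewrite addbT addbF.
by rewrite eq_sym nz addbT negbK addbF.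
Qed.

Lemma odd_ext_of_labels ab : odd_ext (of_labels ab) =1 label_val ab.
Proof.
case=> i [] /=; rewrite /odd_ext /= ffunE //.
by rewrite -label_val_sneg.
Qed.

Definition inj_labels : {set labels} :=
  setX [set a : {ffun pairT -> 'I_y} | injectiveb a] [set: {ffun pairT -> bool}].

Lemma card_inj_labels :
  #|inj_labels| = y ^_ #|block_pairs p| * 2 ^ #|block_pairs p|.
Proof.
by rewrite cardsX cardsT card_inj_ffuns card_ffun card_ord card_bool card_sig.
Qed.

Lemma kernel_of_labels ab : ab \in inj_labels -> kernel_bnpart (of_labels ab) = p.
Proof.
rewrite !inE andbT => /injectiveP ainj.
apply/eqP/kernel_bnpartP => x z; rewrite !odd_ext_of_labels.
apply/eqP/eqP => [|e]; last by rewrite /label_val /pair_of e.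
have [zx|nx] := eqVneq (bneg (blk p x)) (blk p x);
  have [zz|nz] := eqVneq (bneg (blk p z)) (blk p z).
- by move=> _; apply: (@zero_block_uniq _ p); rewrite ?blk_in.
- have h : pair_of p z \in block_pairs p by rewrite pair_ofP.
  by rewrite label_val_zero// (@label_valP _ z (mkpair h)).
- have h : pair_of p x \in block_pairs p by rewrite pair_ofP.
  by rewrite (label_val_zero ab zz) (@label_valP _ x (mkpair h)).
have hx : pair_of p x \in block_pairs p by rewrite pair_ofP.
have hz : pair_of p z \in block_pairs p by rewrite pair_ofP.
rewrite (@label_valP _ x (mkpair hx))// (@label_valP _ z (mkpair hz))//=.
case=> /ainj[e]; have -> : mkpair hz = mkpair hx :> pairT by exact: val_inj.
move=> /addbI; rewrite e.
have : blk p x \in pair_of p z by rewrite -e set21.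
have := rep_in p z; rewrite !inE => /orP[] /eqP -> /orP[] /eqP ->;
  by rewrite ?eqxx ?nz // 1?eq_sym ?nz//= => /esym/eqP; rewrite (negbTE nz).
Qed.

Lemma of_labels_inj : injective of_labels.
Proof.
move=> [a b] [a' b'] e.
suff h q : a q = a' q /\ b q = b' q.
  by congr pair; apply/ffunP => q; case: (h q).
have [x [xq xr _]] := rep_ex (valP q).
have := odd_ext_of_labels (a, b) x; rewrite e odd_ext_of_labels.
rewrite !(@label_valP _ x q)// xr eqxx !addbF => -[-> ->//].
Qed.

Lemma of_labels_surj f : kernel_bnpart f = p ->
  exists2 ab, ab \in inj_labels & f = of_labels ab.
Proof.
move=> /eqP/kernel_bnpartP h.
have nzE x : bneg (blk p x) != blk p x -> odd_ext f x <> None.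
  by move=> nz e; move: nz; rewrite -blk_sneg -h odd_ext_sneg e.
have hx (q : pairT) : exists xv : signed n * signed y,
    [/\ pair_of p xv.1 = val q, blk p xv.1 = rep (val q) & odd_ext f xv.1 = Some xv.2].
  have [x [xq xr nz]] := rep_ex (valP q).
  have := nzE x nz; case ev : (odd_ext f x) => [v|//] _.
  by exists (x, v).
have {hx}[xv hxv] := fin_all_exists hx.
pose a := [ffun q : pairT => (xv q).2.1].
pose b := [ffun q : pairT => (xv q).2.2].
exists (a, b).
  rewrite !inE andbT; apply/injectiveP => q q'; rewrite !ffunE => e.
  have [e1 e2 e3] := hxv q; have [e1' e2' e3'] := hxv q'.
  apply: val_inj; rewrite -e1 -e1'.
  have [eb|/eqP nb] := eqVneq (xv q).2.2 (xv q').2.2.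
    suff /eqP : blk p (xv q).1 == blk p (xv q').1 by rewrite /pair_of => ->.
    by rewrite -h e3 e3' [_.2]surjective_pairing e eb -surjective_pairing.
  suff /eqP eb : blk p (xv q).1 == blk p (sneg (xv q').1).
    by rewrite -(pair_of_sneg p (xv q').1) /pair_of eb.
  rewrite -h odd_ext_sneg e3 e3' /= /sneg -e.
  apply/eqP; congr Some; rewrite [LHS]surjective_pairing; congr pair.
  by move: nb; case: (_.2.2); case: (_.2.2).
apply: odd_ext_inj => x; rewrite odd_ext_of_labels.
have [zx|nx] := eqVneq (bneg (blk p x)) (blk p x).
  rewrite label_val_zero//; case ev : (odd_ext f x) => [v|//].
  have := h (sneg x) x; rewrite blk_sneg zx eqxx odd_ext_sneg ev /=.
  by rewrite (inj_eq Some_inj) (negbTE (sneg_neq v)).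
have hx : pair_of p x \in block_pairs p by rewrite pair_ofP.
pose q : pairT := mkpair hx.
rewrite (@label_valP _ x q)//= !ffunE; have [e1 e2 e3] := hxv q.
have : blk p (xv q).1 \in pair_of p x by rewrite -[pair_of p x]/(val q) -e1 set21.
rewrite -e2 !inE => /orP[/eqP eb|].
  rewrite eb eqxx addbF -surjective_pairing -e3.
  by apply/eqP; rewrite h eb.
rewrite -blk_sneg => /eqP eb.
rewrite eb blk_sneg eq_sym nx addbT.
have /eqP : odd_ext f x == odd_ext f (sneg (xv q).1).
  by rewrite h blk_sneg eb blk_sneg bnegK.
by rewrite odd_ext_sneg e3.
Qed.

Lemma card_kernel_fiber :
  #|[set f | kernel_bnpart f == p]|
  = y ^_ #|block_pairs p| * 2 ^ #|block_pairs p|.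
Proof.
rewrite -card_inj_labels -(card_imset _ of_labels_inj).
apply: eq_card => f; rewrite inE; apply/eqP/imsetP => [/of_labels_surj|[ab abi ->]].
  by case=> ab abi ->; exists ab.
exact: kernel_of_labels.
Qed.

End Fiber.

(** Both sides count the odd functions to {-y, .., y}, encoded as option (signed y):
    the right-hand side does so kernel by kernel. *)
Lemma odd_power_sum :
  y.*2.+1 ^ n = \sum_(p : bnpart n) y ^_ #|block_pairs p| * 2 ^ #|block_pairs p|.
Proof.
have -> : y.*2.+1 ^ n = \sum_(f : {ffun 'I_n -> option (signed y)}) 1.
  by rewrite sum1_card card_ffun card_option card_prod card_bool !card_ord muln2.
rewrite (partition_big kernel_bnpart predT)//=; apply: eq_bigr => p _.
rewrite -card_kernel_fiber -sum1_card; apply: eq_bigl => f.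
by rewrite inE.
Qed.

End Kernel.

From mathcomp Require Import all_order all_algebra.
From mathcomp Require Import ring lra zify.
From mathcomp Require Import all_classical all_reals all_analysis.
From mathcomp Require Import measurable_realfun.
Import Order.TTheory GRing.Theory Num.Theory.
Import numFieldNormedType.Exports.
Local Open Scope classical_set_scope.
Local Open Scope ring_scope.

(** * Sequences with bounded second differences *)

Section Concave.
Variable R : realType.
Implicit Types (u : nat -> R) (j J M : nat).

(** A discrete Taylor inequality: j (j - 1) / 2 is the sum of the integers below j. *)
Lemma second_diff_ub u (delta alpha : R) J : u 0 = 0 -> u 1 <= delta ->
  (forall j, (j < J)%N -> u j.+2 - u j.+1 <= u j.+1 - u j - alpha) ->
  forall j, (j <= J.+1)%N -> u j <= delta * j%:R - alpha * (j%:R * (j%:R - 1)) / 2.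
Proof.
move=> u0 u1 h.
have he j : (j <= J)%N -> u j.+1 - u j <= delta - alpha * j%:R.
  elim: j => [|j IH] jJ; first by rewrite u0 mulr0 !subr0.
  by have := IH (ltnW jJ); have := h j jJ; rewrite -[j.+1%:R]natr1; lra.
elim=> [|j IH] jJ; first by rewrite u0; lra.
by have := IH (ltnW jJ); have := he j jJ; rewrite -[j.+1%:R]natr1; lra.
Qed.

Lemma second_diff_lb u (delta beta : R) J : u 0 = 0 -> - delta <= u 1 ->
  (forall j, (j < J)%N -> u j.+1 - u j - beta <= u j.+2 - u j.+1) ->
  forall j, (j <= J.+1)%N -> - delta * j%:R - beta * (j%:R * (j%:R - 1)) / 2 <= u j.
Proof.
move=> u0 u1 h j jJ.
suff : - u j <= delta * j%:R - (- beta) * (j%:R * (j%:R - 1)) / 2 by lra.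
apply: (@second_diff_ub (fun j => - u j) _ _ J) => //; first by rewrite u0 oppr0.
  by lra.
by move=> i iJ /=; have := h i iJ; lra.
Qed.

(** The slope - alpha J that is reached after J steps can only become steeper,
    which gives a linear decay from there on. *)
Lemma concave_tail u (alpha : R) J M : 0 <= alpha -> u 0 = 0 -> u 1 <= 0 ->
  (forall j, (j.+1 < M)%N -> u j.+2 - u j.+1 <= u j.+1 - u j) ->
  (forall j, (j.+1 < M)%N -> (j < J)%N -> u j.+2 - u j.+1 <= u j.+1 - u j - alpha) ->
  forall j, (j <= M)%N -> u j <= - (alpha * J%:R * (j%:R - J%:R)).
Proof.
move=> a0 u0 u1 h hJ.
have he j : (j < M)%N -> u j.+1 - u j <= - alpha * (minn j J)%:R.
  elim: j => [|j IH] jM; first by rewrite u0 min0n mulr0 subr0.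
  have := IH (ltnW jM); have [jJ|Jj] := ltnP j J.
    rewrite (minn_idPl jJ) -[j.+1%:R]natr1.
    by have := hJ j jM jJ; lra.
  by rewrite (minn_idPr (leqW Jj)); have := h j jM; lra.
have hle j : (j <= M)%N -> u j <= 0.
  elim: j => [|j IH] jM; first by rewrite u0.
  have := he j jM; have := IH (ltnW jM).
  have : 0 <= alpha * (minn j J)%:R by rewrite mulr_ge0.
  lra.
elim=> [|j IH] jM.
  by rewrite u0 sub0r mulrN opprK !mulr_ge0.
have [jJ|Jj] := ltnP j J.
  apply: le_trans (hle _ jM) _.
  rewrite -mulrN opprB mulr_ge0// ?mulr_ge0//.
  by rewrite subr_ge0 ler_nat.
have := IH (ltnW jM); have := he j jM.
by rewrite (minn_idPr Jj) -[j.+1%:R]natr1; lra.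
Qed.

End Concave.

(** * The weights of the law of xi_n + Z *)

Section Weight.
Variable R : realType.
Implicit Types (n y k : nat).

(** The law of xi_n + Z, up to normalization. *)
Definition wt n y : R := y.*2.+1%:R ^+ n / (2 ^ y * y`!)%:R.

Definition lwt n y : R := ln (wt n y).

Lemma wt_gt0 n y : 0 < wt n y.
Proof. by rewrite divr_gt0 ?exprn_gt0 ?ltr0n// muln_gt0 expn_gt0 fact_gt0. Qed.

Lemma wt_exp n y : wt n y = expR (lwt n y).
Proof. by rewrite lnK// posrE wt_gt0. Qed.

Lemma lwt_diff n y : lwt n y.+1 - lwt n y =
  n%:R * ln ((2 * y%:R + 3) / (2 * y%:R + 1)) - ln (2 * (y%:R + 1)).
Proof.
have y0 : 0 <= y%:R :> R by [].
have e : wt n y.+1 = wt n y * ((2 * y%:R + 3) / (2 * y%:R + 1)) ^+ n / (2 * (y%:R + 1)).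
  rewrite /wt expnS factS !natrM -!mul2n -[(2 * y.+1).+1%:R]natr1.
  rewrite -[(2 * y).+1%:R]natr1 !natrM -[y.+1%:R]natr1.
  have : (y`!)%:R != 0 :> R by rewrite pnatr_eq0 -lt0n fact_gt0.
  have : (2 ^ y)%:R != 0 :> R by rewrite pnatr_eq0 -lt0n expn_gt0.
  have -> : 2 * (y%:R + 1) + 1 = 2 * y%:R + 3 :> R by lra.
  move=> h1 h2; rewrite expr_div_n; field.
  by rewrite h1 h2 /= expf_neq0 /=; lra.
have r0 : 0 < (2 * y%:R + 3) / (2 * y%:R + 1) :> R by rewrite divr_gt0; lra.
rewrite /lwt e lnM ?posrE ?mulr_gt0 ?wt_gt0 ?exprn_gt0 ?invr_gt0//; try lra.
rewrite lnM ?posrE ?wt_gt0 ?exprn_gt0// lnXn// lnV ?posrE; last by lra.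
by rewrite -mulr_natl; lra.
Qed.

Lemma ln_ub (t : R) : 0 < t -> ln t <= t - 1.
Proof.
move=> t0; have -> : t = 1 + (t - 1) by lra.
by apply: le_trans (le_ln1Dx _) _; lra.
Qed.

Lemma ln_lb (t : R) : 0 < t -> 1 - t^-1 <= ln t.
Proof.
move=> t0; have := @ln_ub t^-1; rewrite invr_gt0 => /(_ t0).
by rewrite lnV ?posrE//; lra.
Qed.

End Weight.

(** * The mode of the weights *)

Section Mode.
Variable R : realType.
Implicit Types (n y k : nat).
Local Notation lwt := (@lwt R).
Local Notation wt := (@wt R).

(** The approximate value at x of minus the second difference of lwt n. *)
Definition curv n (x : R) : R := n%:R / x ^+ 2 + x^-1.

Definition dlwt n y : R :=
  (lwt n y.+1 - lwt n y) - (lwt n y.+2 - lwt n y.+1).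

Lemma dlwtE n y : dlwt n y =
  n%:R * ln ((2 * y%:R + 3) ^+ 2 / ((2 * y%:R + 1) * (2 * y%:R + 5)))
  + ln ((y%:R + 2) / (y%:R + 1)).
Proof.
have y0 : 0 <= y%:R :> R by [].
rewrite /dlwt !lwt_diff -[y.+1%:R]natr1.
have -> : 2 * (y%:R + 1) + 3 = 2 * y%:R + 5 :> R by lra.
have -> : 2 * (y%:R + 1) + 1 = 2 * y%:R + 3 :> R by lra.
have -> : y%:R + 1 + 1 = y%:R + 2 :> R by lra.
have p1 : 0 < 2 * y%:R + 1 :> R by lra.
have p3 : 0 < 2 * y%:R + 3 :> R by lra.
have p5 : 0 < 2 * y%:R + 5 :> R by lra.
have q1 : 0 < y%:R + 1 :> R by lra.
have q2 : 0 < y%:R + 2 :> R by lra.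
rewrite !ln_div ?posrE ?mulr_gt0 ?exprn_gt0// lnXn// !lnM ?posrE//.
by rewrite -mulr_natl; lra.
Qed.

(** The arguments of both logarithms in dlwtE are close to 1, and ln t lies
    between 1 - 1 / t and t - 1. *)
Lemma dlwt_ub n y : (0 < y)%N -> dlwt n y <= curv n y%:R.
Proof.
move=> y0; have {}y0 : 1 <= y%:R :> R by rewrite ler1n.
rewrite dlwtE /curv; apply: lerD.
  rewrite ler_wpM2l//; apply: le_trans (ln_ub _) _.
    by rewrite divr_gt0 ?mulr_gt0 ?exprn_gt0//; lra.
  have -> : (2 * y%:R + 3) ^+ 2 / ((2 * y%:R + 1) * (2 * y%:R + 5)) - 1
     = 4 / ((2 * y%:R + 1) * (2 * y%:R + 5)) :> R.
    by field; apply/andP; split; lra.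
  rewrite -[leRHS]mul1r ler_pdivrMr; last by rewrite mulr_gt0; lra.
  rewrite mul1r mulrC ler_pdivlMr; last by rewrite exprn_gt0; lra.
  by nra.
apply: le_trans (ln_ub _) _; first by rewrite divr_gt0; lra.
have -> : (y%:R + 2) / (y%:R + 1) - 1 = (y%:R + 1)^-1 :> R by field; lra.
by rewrite lef_pV2 ?posrE; lra.
Qed.

Lemma dlwt_lb n y : curv n (y%:R + 2) <= dlwt n y.
Proof.
have y0 : 0 <= y%:R :> R by [].
rewrite dlwtE /curv; apply: lerD.
  rewrite ler_wpM2l//; apply: le_trans (ln_lb _); last first.
    by rewrite divr_gt0 ?mulr_gt0 ?exprn_gt0//; lra.
  have -> : 1 - ((2 * y%:R + 3) ^+ 2 / ((2 * y%:R + 1) * (2 * y%:R + 5)))^-1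
     = 4 / (2 * y%:R + 3) ^+ 2 :> R.
    by field; rewrite ?expf_neq0//=; do ?[apply/andP; split]; lra.
  rewrite -[leLHS]mul1r ler_pdivrMr; last by rewrite exprn_gt0; lra.
  rewrite mulrC mulrA ler_pdivlMr; last by rewrite exprn_gt0; lra.
  by nra.
apply: le_trans (ln_lb _); last by rewrite divr_gt0; lra.
suff -> : 1 - ((y%:R + 2) / (y%:R + 1))^-1 = (y%:R + 2)^-1 :> R by [].
by field; apply/andP; split; lra.
Qed.

Lemma curv_ge0 n x : 0 <= x -> 0 <= curv n x.
Proof. by move=> x0; rewrite addr_ge0 ?divr_ge0 ?exprn_ge0 ?invr_ge0. Qed.

Lemma curv_gt0 n x : 0 < x -> 0 < curv n x.
Proof.
by move=> x0; rewrite ltr_wpDl ?divr_ge0 ?exprn_ge0 ?invr_gt0// ltW.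
Qed.

Lemma dlwt_ge0 n y : 0 <= dlwt n y.
Proof. by apply: le_trans (dlwt_lb _ _); rewrite curv_ge0. Qed.

Lemma mode_ex n : exists y, wt n y.+1 < wt n y.
Proof.
(* The numerator of wt grows by at most 3 ^ n from y to y + 1, the denominator
   by 2 (y + 1). *)
exists (3 ^ n)%N; rewrite !wt_exp ltr_expR -subr_lt0 lwt_diff.
have y0 : 0 <= (3 ^ n)%:R :> R by [].
set y : R := (3 ^ n)%:R in y0 *.
have h : ln ((2 * y + 3) / (2 * y + 1)) <= ln 3 :> R.
  rewrite ler_ln ?posrE ?divr_gt0; try lra.
  by rewrite ler_pdivrMr; lra.
have : n%:R * ln ((2 * y + 3) / (2 * y + 1)) <= n%:R * ln 3.
  by rewrite ler_wpM2l.
rewrite [X in _ <= X]mulr_natl -lnXn// -natrX -/y => {}h.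
suff : ln y < ln (2 * (y + 1)) by lra.
rewrite ltr_ln ?posrE; try lra.
by rewrite /y ltr0n expn_gt0.
Qed.

Definition mode n := ex_minn (mode_ex n).

Lemma mode_lt n : lwt n (mode n).+1 < lwt n (mode n).
Proof. by rewrite /mode; case: ex_minnP => m; rewrite !wt_exp ltr_expR. Qed.

Lemma mode_min n y : (y < mode n)%N -> lwt n y <= lwt n y.+1.
Proof.
rewrite /mode; case: ex_minnP => m _ h ym.
rewrite leNgt; apply/negP => hlt.
by have := h y; rewrite !wt_exp ltr_expR => /(_ hlt); rewrite leqNgt ym.
Qed.

Lemma mode_gt0 n : (0 < n)%N -> (0 < mode n)%N.
Proof.
case: n => // n _; rewrite lt0n; apply/eqP => e.
have := mode_lt n.+1; rewrite e -ltr_expR -!wt_exp /wt /= expr1n.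
rewrite !expn1 expn0 fact0 mul1n divr1 muln1 ltr_pdivrMr// mul1r.
rewrite exprS (_ : 1.*2.+1 = 3)%N//; have : 1 <= 3 ^+ n :> R by rewrite exprn_ege1// ler1n.
by lra.
Qed.

(** At the mode m the weights decrease, so n ln ((2 m + 3) / (2 m + 1)) is less than
    ln (2 m + 2). The former is at least n / (m + 2), the latter at most
    2 sqrt (2 m + 2). This crude bound is enough for n / m^2 to tend to 0. *)
Lemma mode_large n : n%:R ^+ 2 <= 8 * ((mode n)%:R + 2) ^+ 3 :> R.
Proof.
have := mode_lt n; rewrite -subr_lt0 lwt_diff.
have m0 : 0 <= (mode n)%:R :> R by [].
set m : R := (mode n)%:R in m0 * => h.
have h1 : n%:R * (m + 2)^-1 <= n%:R * ln ((2 * m + 3) / (2 * m + 1)).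
  rewrite ler_wpM2l//; apply: le_trans (ln_lb _); last by rewrite divr_gt0; lra.
  have -> : 1 - ((2 * m + 3) / (2 * m + 1))^-1 = 2 / (2 * m + 3).
    by field; apply/andP; split; lra.
  by rewrite ler_pdivlMr; [rewrite mulrC ler_pdivrMr; lra|lra].
have h2 : ln (2 * (m + 1)) <= 2 * Num.sqrt (2 * (m + 1)).
  rewrite -{1}[2 * (m + 1)]sqr_sqrtr; last lra.
  have s0 : 0 < Num.sqrt (2 * (m + 1)) by rewrite sqrtr_gt0; lra.
  by rewrite lnXn// mulr2n; have := ln_sublinear s0; lra.
have h3 : n%:R <= (m + 2) * (2 * Num.sqrt (2 * (m + 1))).
  have : n%:R * (m + 2)^-1 <= 2 * Num.sqrt (2 * (m + 1)) by lra.
  by rewrite ler_pdivrMr; [rewrite mulrC|lra].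
apply: (@le_trans _ _ (((m + 2) * (2 * Num.sqrt (2 * (m + 1)))) ^+ 2)).
  by rewrite ler_sqr ?nnegrE// mulr_ge0 ?mulr_ge0 ?sqrtr_ge0//; lra.
rewrite !exprMn sqr_sqrtr; last lra.
by have := sqr_ge0 (m + 2); nra.
Qed.

End Mode.

(** * The width of the weights *)

Section Scale.
Variable R : realType.
Implicit Types (n y k : nat).
Local Notation mode := (mode R).
Local Notation m n := ((mode n)%:R : R).

Lemma mode_ge (A : R) : \forall n \near \oo, A <= m n.
Proof.
near=> n.
have [//|mA] := leP A (m n).
have m0 : 0 <= m n by [].
have n1 : 1 <= n%:R :> R by rewrite ler1n; near: n; exact: nbhs_infty_gt.
have h : 8 * (A + 2) ^+ 3 < n%:R by near: n; exact: nbhs_infty_gtr.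
have := mode_large R n.
have : (m n + 2) ^+ 3 <= (A + 2) ^+ 3.
  by rewrite lerXn2r// ?nnegrE; lra.
by nra.
Unshelve. all: by end_near. Qed.

Lemma curv_small (e : R) : 0 < e -> \forall n \near \oo, curv n (m n) <= e.
Proof.
move=> e0; near=> n.
have m2 : 2 <= m n by near: n; exact: mode_ge.
have m1 : 2 / e <= m n by near: n; exact: mode_ge.
(* As m + 2 <= 3 m, n^2 is at most 216 m^3, hence (n / m^2)^2 is at most 216 / m. *)
have m3 : 216 * 4 / e ^+ 2 <= m n by near: n; exact: mode_ge.
rewrite [e]splitr; apply: lerD.
  rewrite ler_pdivrMr ?exprn_gt0; [|lra..].
  rewrite -ler_sqr ?nnegrE// ?mulr_ge0 ?exprn_ge0; [|lra..].
  apply: le_trans (mode_large R n) _.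
  have : (m n + 2) ^+ 3 <= (3 * m n) ^+ 3 by rewrite lerXn2r// ?nnegrE; lra.
  move: m3; rewrite ler_pdivrMr ?exprn_gt0// => m3.
  have : 216 * 4 * m n ^+ 3 <= m n * e ^+ 2 * m n ^+ 3.
    by rewrite ler_wpM2r// exprn_ge0.
  by rewrite !exprMn; lra.
by rewrite -[leRHS]invrK invf_div lef_pV2// posrE ?divr_gt0//; lra.
Unshelve. all: by end_near. Qed.

(** The standard deviation of the Gaussian whose log-density has second derivative
    - curv n (m n), close to the second difference of lwt n at the mode. *)
Definition scale n : R := (Num.sqrt (curv n (m n)))^-1.

Lemma scale_gt0 n : (0 < n)%N -> 0 < scale n.
Proof.
by move=> n0; rewrite invr_gt0 sqrtr_gt0 curv_gt0// ltr0n mode_gt0.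
Qed.

Lemma scale_sqr n : (0 < n)%N -> curv n (m n) = (scale n ^+ 2)^-1.
Proof.
move=> n0; rewrite /scale exprVn invrK sqr_sqrtr//.
by rewrite ltW// curv_gt0// ltr0n mode_gt0.
Qed.

Lemma scale_ge (A : R) : \forall n \near \oo, A <= scale n.
Proof.
wlog A0 : A / 0 < A.
  move=> /(_ (Num.max A 1)); rewrite lt_max ltr01 orbT => /(_ isT).
  by apply: filterS => n; apply: le_trans; rewrite le_max lexx.
near=> n.
have n0 : (0 < n)%N by near: n; exact: nbhs_infty_gt.
have : curv n (m n) <= (A ^+ 2)^-1.
  by near: n; apply: curv_small; rewrite invr_gt0 exprn_gt0.
rewrite scale_sqr// lef_pV2 ?posrE ?exprn_gt0 ?scale_gt0//.
by rewrite ler_sqr// ?nnegrE ltW// scale_gt0.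
Unshelve. all: by end_near. Qed.

(** The summand 1 / x of curv, which comes from y!, keeps the width of the weights
    below the square root of the mode. *)
Lemma scale_le_mode n : (0 < n)%N -> scale n ^+ 2 <= m n.
Proof.
move=> n0; have m0 : 0 < m n by rewrite ltr0n mode_gt0.
rewrite -lef_pV2 ?posrE ?exprn_gt0 ?scale_gt0// -scale_sqr// /curv.
by rewrite lerDr divr_ge0.
Qed.

Lemma curv_scale n (c x y : R) : 0 < c <= 1 -> 0 < x -> c * x <= y ->
  curv n y <= curv n x / c ^+ 2.
Proof.
move=> /andP[c0 c1] x0 cxy.
have cx0 : 0 < c * x by rewrite mulr_gt0.
have y0 : 0 < y by apply: lt_le_trans cxy.
rewrite /curv mulrDl -mulrA -invfM -exprMn [x * c]mulrC; apply: lerD.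
  by rewrite ler_wpM2l// lef_pV2 ?posrE ?exprn_gt0// lerXn2r// nnegrE ltW.
rewrite -invfM lef_pV2 ?posrE ?mulr_gt0 ?exprn_gt0//.
apply: le_trans cxy; rewrite mulrC ler_pM2r//; nra.
Qed.

(** The window has relative width K / sqrt m, and curv varies at most like the
    inverse square of its argument. *)
Lemma dlwt_near (K e : R) : 0 <= K -> 0 < e -> \forall n \near \oo,
  forall y, `|y%:R - m n| <= K * scale n ->
    (1 - e) * curv n (m n) <= dlwt R n y <= (1 + e) * curv n (m n).
Proof.
move=> K0 e0; (* (1 + 2 h)^-2 and (1 - h)^-2 lie between 1 - 4 h and 1 + 4 h for these h. *)
pose h : R := Num.min (e / 4) (1 / 4).
have h0 : 0 < h by rewrite lt_min; apply/andP; split; lra.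
have he : h <= e / 4 by rewrite ge_min lexx.
have h4 : h <= 1 / 4 by rewrite ge_min lexx orbT.
near=> n => y yK.
have n0 : (0 < n)%N by near: n; exact: nbhs_infty_gt.
have m0 : 0 < m n by rewrite ltr0n mode_gt0.
have s0 := scale_gt0 n0.
have mh : 2 / h <= m n by near: n; exact: mode_ge.
have mK : (K / h) ^+ 2 <= m n by near: n; exact: mode_ge.
have Ks : K * scale n <= h * m n.
  rewrite -ler_sqr ?nnegrE ?mulr_ge0 ?(ltW h0) ?(ltW s0)//.
  rewrite !exprMn; move: mK; rewrite expr_div_n ler_pdivrMr ?exprn_gt0// => mK.
  have h1 : K ^+ 2 * scale n ^+ 2 <= m n * h ^+ 2 * m n.
    by rewrite ler_pM ?sqr_ge0 ?scale_le_mode.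
  by apply: le_trans h1 _; rewrite expr2; lra.
have {}mh : 2 <= h * m n by move: mh; rewrite ler_pdivrMr// mulrC.
have := le_trans yK Ks; rewrite ler_norml => /andP[yl yu].
have hm : h * m n <= m n / 4 by have := ler_wpM2r (ltW m0) h4; lra.
have C0 := curv_gt0 n m0.
have ygt : 0 < y%:R :> R by lra.
apply/andP; split.
  apply: le_trans (dlwt_lb _ _ _).
  have h2 : 0 < (1 + 2 * h)^-1 <= 1.
    by rewrite invr_gt0 invf_le1; lra.
  have := @curv_scale n _ (y%:R + 2) (m n) h2.
  have q : 0 < y%:R + 2 :> R by lra.
  have hy : (1 + 2 * h)^-1 * (y%:R + 2) <= m n.
    by rewrite mulrC ler_pdivrMr; lra.
  move=> /(_ q hy); rewrite exprVn invrK => H.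
  have : (1 - 4 * h) * (1 + 2 * h) ^+ 2 <= 1 by nra.
  have D0 : 0 < curv n (y%:R + 2 : R) by exact: curv_gt0.
  move=> H2.
  have H3 : (1 - 4 * h) * curv n (m n) <= curv n (y%:R + 2).
    apply: (@le_trans _ _ ((1 - 4 * h) * (curv n (y%:R + 2) * (1 + 2 * h) ^+ 2))).
      by rewrite ler_wpM2l//; lra.
    by rewrite mulrCA -[leRHS]mulr1 ler_wpM2l// ltW.
  apply: le_trans H3; rewrite ler_wpM2r ?(ltW C0)//; lra.
apply: le_trans (dlwt_ub _ _ _) _; first by rewrite -(ltr0n R).
have h2 : 0 < 1 - h <= 1 by lra.
have := @curv_scale n _ (m n) y%:R h2 m0.
have hh : (1 - h) * m n <= y%:R by lra.
move=> /(_ hh) H; apply: le_trans H _.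
rewrite mulrC ler_wpM2r ?(ltW C0)//.
rewrite -[leLHS]mul1r ler_pdivrMr; last by rewrite exprn_gt0; lra.
have : 1 <= (1 + 4 * h) * (1 - h) ^+ 2 by nra.
move=> H; apply: le_trans H _.
by rewrite ler_wpM2r ?sqr_ge0//; lra.
Unshelve. all: by end_near. Qed.

End Scale.

(** * Gaussian shape and exponential tails *)

Section Shape.
Variable R : realType.
Implicit Types (n y k : nat).
Local Notation lwt := (@lwt R).
Local Notation mode := (mode R).
Local Notation scale := (scale R).
Local Notation m n := ((mode n)%:R : R).

(** The error 3 K / s covers the first step and the replacement of j (j - 1) by j^2;
    the other one is the relative error e on the curvature. *)
Lemma quadratic_near (u : nat -> R) (K e s : R) j0 :
  1 <= K -> 0 < e <= 1 -> 1 <= s -> u 0 = 0 ->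
  - ((1 + e) / s ^+ 2) <= u 1 <= 0 ->
  (forall j, (j.+2 <= j0)%N ->
    (1 - e) / s ^+ 2 <= u j.+1 - u j - (u j.+2 - u j.+1) <= (1 + e) / s ^+ 2) ->
  j0%:R <= K * s ->
  `|u j0 + j0%:R ^+ 2 / (2 * s ^+ 2)| <= 3 * K / s + e * K ^+ 2 / 2.
Proof.
move=> K1 /andP[e0 e1] s1 u0 /andP[ul uu] h jK.
have s0 : 0 < s by lra.
set D := (s ^+ 2)^-1; set x := j0%:R in jK *.
have x0 : 0 <= x by [].
have D0 : 0 <= D by rewrite invr_ge0 exprn_ge0// ltW.
have Dx : D * x <= K / s.
  rewrite mulrC ler_pdivrMr ?exprn_gt0//.
  by rewrite -mulrA expr2 mulKf ?gt_eqF.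
have Dx2 : D * x ^+ 2 <= K ^+ 2.
  rewrite mulrC ler_pdivrMr ?exprn_gt0// -exprMn.
  by rewrite ler_sqr ?nnegrE//; lra.
have Dx0 : 0 <= D * x by rewrite mulr_ge0.
have Dx20 : 0 <= D * x ^+ 2 by rewrite mulr_ge0// sqr_ge0.
have jJ : (j0 <= j0.-1.+1)%N by exact: leqSpred.
have hJ j : (j < j0.-1)%N -> (j.+2 <= j0)%N by rewrite ltn_predRL.
have up : u j0 <= 0 * x - (1 - e) * D * (x * (x - 1)) / 2.
  apply: (second_diff_ub u0 uu (J := j0.-1)) => // j /hJ/h/andP[+ _].
  by rewrite -/D; lra.
have lo : - ((1 + e) * D) * x - (1 + e) * D * (x * (x - 1)) / 2 <= u j0.
  apply: (second_diff_lb u0 _ (J := j0.-1)) => // j /hJ/h/andP[_ +].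
  by rewrite -/D; lra.
have -> : x ^+ 2 / (2 * s ^+ 2) = D * x ^+ 2 / 2 by rewrite /D; field; lra.
have eDx2 : e * (D * x ^+ 2) <= e * K ^+ 2 by rewrite ler_wpM2l// ltW.
have eDx : e * (D * x) <= D * x by rewrite -[leRHS]mul1r ler_wpM2r.
have eDx0 : 0 <= e * (D * x) by rewrite mulr_ge0// ltW.
have -> : 3 * K / s = 3 * (K / s) by rewrite mulrA.
by rewrite ler_norml; apply/andP; split; lra.
Qed.

Section Steps.
Variable n : nat.
Hypothesis n0 : (0 < n)%N.

Definition right_inc j : R := lwt n (mode n + j) - lwt n (mode n).
Definition left_inc j : R := lwt n (mode n - j) - lwt n (mode n).

Lemma right_inc0 : right_inc 0 = 0. Proof. by rewrite /right_inc addn0 subrr. Qed.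
Lemma left_inc0 : left_inc 0 = 0. Proof. by rewrite /left_inc subn0 subrr. Qed.

Lemma right_inc1 : - dlwt R n (mode n).-1 <= right_inc 1 <= 0.
Proof.
rewrite /right_inc addn1 /dlwt (prednK (mode_gt0 R n0)).
have := mode_lt R n.
have : lwt n (mode n).-1 <= lwt n (mode n).-1.+1.
  by apply: mode_min; rewrite ltn_predL mode_gt0.
by rewrite (prednK (mode_gt0 R n0)) => h1 h2; apply/andP; split; lra.
Qed.

Lemma left_inc1 : - dlwt R n (mode n).-1 <= left_inc 1 <= 0.
Proof.
rewrite /left_inc subn1 /dlwt (prednK (mode_gt0 R n0)).
have := mode_lt R n.
have : lwt n (mode n).-1 <= lwt n (mode n).-1.+1.
  by apply: mode_min; rewrite ltn_predL mode_gt0.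
by rewrite (prednK (mode_gt0 R n0)) => h1 h2; apply/andP; split; lra.
Qed.

Lemma right_inc_diff j :
  right_inc j.+1 - right_inc j - (right_inc j.+2 - right_inc j.+1)
  = dlwt R n (mode n + j).
Proof. by rewrite /right_inc /dlwt !addnS; lra. Qed.

Lemma left_inc_diff j : (j.+2 <= mode n)%N ->
  left_inc j.+1 - left_inc j - (left_inc j.+2 - left_inc j.+1)
  = dlwt R n (mode n - j.+2).
Proof.
move=> jm; rewrite /left_inc /dlwt.
have -> : (mode n - j = (mode n - j.+2).+2)%N by lia.
have -> : (mode n - j.+1 = (mode n - j.+2).+1)%N by lia.
by lra.
Qed.

End Steps.

(** The mode is only a near-critical point of lwt n: by minimality, the slopes on
    both sides of it differ from 0 by at most one second difference. *)
Lemma lwt_quadratic (K e : R) : 0 <= K -> 0 < e -> \forall n \near \oo,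
  forall y, `|y%:R - m n| <= K * scale n ->
    `|lwt n y - lwt n (mode n) + (y%:R - m n) ^+ 2 / (2 * scale n ^+ 2)| <= e.
Proof.
(* A window of radius at least 1 contains the predecessor of the mode. *)
wlog K1 : K / 1 <= K.
  move=> h K0 e0; have := h (Num.max K 1).
  rewrite le_max lexx orbT => /(_ isT) h1.
  have {}h1 := h1 _ e0; near=> n => y yK.
  have n0 : (0 < n)%N by near: n; exact: nbhs_infty_gt.
  have := yK; have : K * scale n <= Num.max K 1 * scale n.
    by rewrite ler_wpM2r ?le_max ?lexx// ltW// scale_gt0.
  move=> /[swap] /le_trans /[apply].
  move: y yK => y _; move: y; near: n; apply: h1.
  by rewrite le_max K0.
move=> K0 e0; pose h : R := Num.min (e / K ^+ 2) 1.
have K2 : 0 < K ^+ 2 by rewrite exprn_gt0//; lra.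
have h0 : 0 < h by rewrite lt_min divr_gt0//=.
have h1 : h <= 1 by rewrite ge_min lexx orbT.
have he : h * K ^+ 2 <= e by rewrite -ler_pdivlMr// ge_min lexx.
near=> n => y yK.
have n0 : (0 < n)%N by near: n; exact: nbhs_infty_gt.
have s1 : 1 <= scale n by near: n; exact: scale_ge.
have s2 : 6 * K / e <= scale n by near: n; exact: scale_ge.
have hd : forall y, `|y%:R - m n| <= K * scale n ->
    (1 - h) * curv n (m n) <= dlwt R n y <= (1 + h) * curv n (m n).
  by near: n; exact: dlwt_near.
have {}hd z : `|z%:R - m n| <= K * scale n ->
    (1 - h) / scale n ^+ 2 <= dlwt R n z <= (1 + h) / scale n ^+ 2.
  by move/hd; rewrite scale_sqr.
have Ks1 : 1 <= K * scale n by rewrite -[leLHS]mul1r ler_pM.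
have d1 : - ((1 + h) / scale n ^+ 2) <= - dlwt R n (mode n).-1.
  rewrite lerN2; suff /hd/andP[_ //] : `|(mode n).-1%:R - m n| <= K * scale n.
  rewrite -{2}(prednK (mode_gt0 R n0)) -natr1.
  by rewrite opprD addNKr normrN normr1.
have bnd : 3 * K / scale n + h * K ^+ 2 / 2 <= e.
  suff : 3 * K / scale n <= e / 2 by lra.
  rewrite ler_pdivrMr; last lra.
  by move: s2; rewrite ler_pdivrMr//; lra.
apply: le_trans bnd; have h01 : 0 < h <= 1 by rewrite h0.
have [my|ym] := leqP (mode n) y.
  rewrite -(subnKC my) natrD [m n + _]addrC addrK.
  apply: (@quadratic_near (right_inc n)) => //.
  - exact: right_inc0.
  - by have /andP[] := right_inc1 n0 => a b; rewrite (le_trans d1 a) b.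
  - move=> j jy; rewrite right_inc_diff; apply: hd.
    rewrite natrD [m n + _]addrC addrK ger0_norm//.
    move: yK; rewrite -{1}(subnKC my) natrD [m n + _]addrC addrK ger0_norm//.
    by apply: le_trans; rewrite ler_nat; apply: leq_trans jy; exact/leqW/leqnSn.
  by move: yK; rewrite -{1}(subnKC my) natrD [m n + _]addrC addrK ger0_norm.
have ym' := ltnW ym.
have ye : y%:R - m n = - (mode n - y)%:R by rewrite natrB//; lra.
have jK : (mode n - y)%:R <= K * scale n.
  by move: yK; rewrite ye normrN ger0_norm.
rewrite ye sqrrN -{1}(subKn ym').
apply: (@quadratic_near (left_inc n)) => //.
- exact: left_inc0.
- by have /andP[] := left_inc1 n0 => a b; rewrite (le_trans d1 a) b.
- move=> j jy; have jm : (j.+2 <= mode n)%N := leq_trans jy (leq_subr _ _).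
  rewrite left_inc_diff//; apply: hd.
  rewrite natrB// addrC addrA addNr add0r normrN ger0_norm//.
  by apply: le_trans jK; rewrite ler_nat.
Unshelve. all: by end_near. Qed.

(** After J steps with s <= J <= 2 s the slope is at most - 1 / (2 s) on either side
    of the mode, since the curvature is at least 1 / (2 s^2) up to there. *)
Lemma lwt_tail : \forall n \near \oo, forall y,
  lwt n y - lwt n (mode n) <= 2 - `|y%:R - m n| / (2 * scale n).
Proof.
near=> n => y.
have n0 : (0 < n)%N by near: n; exact: nbhs_infty_gt.
have s2 : 2 <= scale n by near: n; exact: scale_ge.
have s0 : 0 < scale n by lra.
have hd : forall y, `|y%:R - m n| <= 3 * scale n ->
    (1 - 1 / 2) * curv n (m n) <= dlwt R n y <= (1 + 1 / 2) * curv n (m n).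
  by near: n; apply: dlwt_near; lra.
pose J := (Num.truncn (scale n)).+1.
have /andP[Jl Ju] := truncn_itv (ltW s0).
have sJ : scale n <= J%:R by exact: ltW.
have J2 : J%:R <= scale n + 1 by rewrite /J -natr1 lerD2r.
pose a : R := curv n (m n) / 2.
have aE : a = (2 * scale n ^+ 2)^-1 by rewrite /a scale_sqr//; field; lra.
have a0 : 0 < a by rewrite aE invr_gt0 mulr_gt0// exprn_gt0.
have fin j : - (a * J%:R * (j%:R - J%:R)) <= 2 - j%:R / (2 * scale n).
  have h1 : a * J%:R ^+ 2 <= 2.
    rewrite aE mulrC ler_pdivrMr; last by rewrite mulr_gt0// exprn_gt0.
    have : J%:R ^+ 2 <= (2 * scale n) ^+ 2.
      by rewrite ler_sqr ?nnegrE//; lra.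
    by rewrite exprMn; lra.
  have h2 : (2 * scale n)^-1 <= a * J%:R.
    have -> : (2 * scale n)^-1 = a * scale n by rewrite aE; field; lra.
    by rewrite ler_wpM2l// ltW.
  have : (2 * scale n)^-1 * j%:R <= a * J%:R * j%:R by rewrite ler_wpM2r.
  by lra.
have [my|ym] := leqP (mode n) y.
  have ye : y%:R - m n = (y - mode n)%:R by rewrite natrB.
  rewrite ye ger0_norm// -{1}(subnKC my); apply: le_trans (fin _).
  apply: (@concave_tail _ (right_inc n) _ _ (y - mode n)%N) => //.
  - exact: ltW.
  - exact: right_inc0.
  - by case/andP: (right_inc1 n0).
  - move=> j _; rewrite -subr_ge0.
    by have := right_inc_diff n j; have := dlwt_ge0 R n (mode n + j); lra.
  - move=> j _ jJ; have := right_inc_diff n j.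
    have /hd/andP[+ _] : `|(mode n + j)%:R - m n| <= 3 * scale n.
      rewrite natrD [m n + _]addrC addrK ger0_norm//.
      have : j%:R <= J%:R :> R by rewrite ler_nat ltnW.
      by lra.
    by rewrite /a; lra.
have ym' := ltnW ym.
have ye : y%:R - m n = - (mode n - y)%:R by rewrite natrB//; lra.
rewrite ye normrN ger0_norm// -{1}(subKn ym'); apply: le_trans (fin _).
apply: (@concave_tail _ (left_inc n) _ _ (mode n)) => //.
- exact: ltW.
- exact: left_inc0.
- by case/andP: (left_inc1 n0).
- move=> j jm; rewrite -subr_ge0.
  by have := left_inc_diff n0 jm; have := dlwt_ge0 R n (mode n - j.+2); lra.
- move=> j jm jJ; have := left_inc_diff n0 jm.
  have /hd/andP[+ _] : `|(mode n - j.+2)%:R - m n| <= 3 * scale n.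
    rewrite natrB// addrC addrA addNr add0r normrN ger0_norm//.
    have : j.+2%:R <= J.+1%:R :> R by rewrite ler_nat.
    by rewrite -[J.+1%:R]natr1; lra.
  by rewrite /a; lra.
- exact: leq_subr.
Unshelve. all: by end_near. Qed.

End Shape.

(** * Riemann sums as integrals of step functions *)

Section Step.
Variable R : realType.
Local Notation mu := (@lebesgue_measure R).
Implicit Types (a : nat -> R) (m y : nat) (s x : R).

(** The function with value a y on [(y - m) / s, (y + 1 - m) / s) for each natural
    number y, and 0 on the left of these intervals. *)
Definition step a m s x : R :=
  let z := m%:Z + Num.floor (s * x) in if 0 <= z then a (absz z) else 0.

Definition cell m s y : set R := `[(y%:R - m%:R) / s, (y.+1%:R - m%:R) / s[%classic.

Lemma cellP m s y x : 0 < s -> cell m s y x <-> m%:Z + Num.floor (s * x) = y%:Z.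
Proof.
move=> s0; rewrite /cell /= in_itv/= ler_pdivrMr// ltr_pdivlMr// [x * s]mulrC.
have -> : (y%:R - m%:R <= s * x < y.+1%:R - m%:R) =
          (Num.floor (s * x) == y%:Z - m%:Z).
  rewrite floor_eq !intrD mulrNz -[y.+1%:R]natr1.
  by rewrite -!pmulrn [_ - _ + 1]addrAC.
by split=> [/eqP ->|<-]; lia.
Qed.

Lemma cell_measurable m s y : measurable (cell m s y).
Proof. exact: measurable_itv. Qed.

Lemma cell_trivIset m s : 0 < s -> trivIset setT (cell m s).
Proof.
move=> s0 i j _ _ [x [/(cellP _ _ _ s0) + /(cellP _ _ _ s0)]].
by move=> -> [].
Qed.

Lemma step_cell a m s y x : 0 < s -> cell m s y x -> step a m s x = a y.
Proof. by move=> s0 /(cellP _ _ _ s0) e; rewrite /step e. Qed.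

Lemma step_out a m s x : 0 < s -> ~ (\bigcup_y cell m s y) x -> step a m s x = 0.
Proof.
move=> s0 h; rewrite /step; case: ifPn => // z0; exfalso; apply: h.
exists (absz (m%:Z + Num.floor (s * x))) => //; apply/cellP => //.
by rewrite gez0_abs.
Qed.

Lemma measurable_step a m s : 0 < s -> measurable_fun [set: R] (step a m s).
Proof.
move=> s0; rewrite -(setUv (\bigcup_y cell m s y)).
have mU : measurable (\bigcup_y cell m s y).
  by apply: bigcupT_measurable => y; exact: cell_measurable.
apply/measurable_funU => //; first exact: measurableC.
split.
  apply/measurable_fun_bigcup => [y|y]; first exact: cell_measurable.
  apply: (@eq_measurable_fun _ _ _ _ _ (cst (a y))); last exact: measurable_cst.
  by move=> x; rewrite inE => /step_cell ->.
apply: (@eq_measurable_fun _ _ _ _ _ (cst (0 : R))); last exact: measurable_cst.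
by move=> x; rewrite inE => /step_out ->.
Qed.

Lemma integral_step a m s : 0 < s -> (forall y, 0 <= a y) ->
  (\int[mu]_x (step a m s x)%:E = \sum_(y <oo) (a y / s)%:E)%E.
Proof.
move=> s0 a0.
have mU : measurable (\bigcup_y cell m s y).
  by apply: bigcupT_measurable => y; exact: cell_measurable.
have st0 x : (0 <= (step a m s x)%:E)%E by rewrite lee_fin /step; case: ifP.
rewrite -(setUv (\bigcup_y cell m s y)) ge0_integral_setU//=; last 3 first.
- exact: measurableC.
- by apply/measurable_EFinP; rewrite setUv; exact: measurable_step.
- exact/disj_setPCl.
rewrite [X in (_ + X)%E]integral0_eq ?adde0; last first.
  by move=> x /step_out ->.
rewrite ge0_integral_bigcup//; last 3 first.
- by move=> y; exact: cell_measurable.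
- by apply/measurable_EFinP; apply: measurable_funTS; exact: measurable_step.
- exact: cell_trivIset.
apply: eq_eseriesr => y _.
under eq_integral => x.
  rewrite inE => /step_cell ->//; over.
rewrite integral_cst; last exact: cell_measurable.
rewrite /cell /= lebesgue_measure_itv /= lte_fin ltr_pM2r ?invr_gt0//.
rewrite ltrD2r ltr_nat ltnSn -EFinD -EFinM; congr (_ * _)%:E.
by rewrite -[y.+1%:R]natr1; field; lra.
Qed.

Lemma integrable_expR_norm : mu.-integrable [set: R]
  (EFin \o (fun x : R => expR (- (`|x| / 4)))).
Proof.
have c : continuous (fun x : R => expR (- (`|x| / 4))).
  move=> x; apply: continuous_comp; last exact: continuous_expR.
  apply: continuousN; apply: continuousM; last exact: cst_continuous.
  exact: norm_continuous.
have me : measurable_fun [set: R] (EFin \o (fun x : R => expR (- (`|x| / 4)))).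
  by apply/measurable_EFinP; exact: continuous_measurable_fun.
apply/integrableP; split=> //.
under eq_integral do rewrite /= ger0_norm ?expR_ge0//.
rewrite ge0_symfun_integralT; last 3 first.
- by move=> x; exact: expR_ge0.
- exact: c.
- by move=> x /=; rewrite normrN.
rewrite lte_mul_pinfty//.
have r4 : 0 < 4^-1 :> R by rewrite invr_gt0.
have -> : [set x : R | 0 <= x] = `[0, +oo[%classic.
  by apply/seteqP; split=> x /=; rewrite in_itv/= andbT.
apply: (@le_lt_trans _ _ (\int[mu]_(x in `[0%R, +oo[) (4%:E * (exponential_pdf 4^-1 x)%:E))%E).
  apply: ge0_le_integral => //.
  - exact: measurable_funTS.
  - apply: measurable_funTS; apply: measurable_funeM.
    by apply/measurable_EFinP; exact: measurable_exponential_pdf.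
  - move=> x; rewrite /= in_itv/= andbT => x0; rewrite -EFinM lee_fin.
    rewrite exponential_pdfE// mulrA divff// mul1r ger0_norm//.
    by rewrite mulNr mulrC.
rewrite ge0_integralZl//; last 2 first.
- by apply: measurable_funTS; apply/measurable_EFinP; exact: measurable_exponential_pdf.
- by move=> x _; rewrite lee_fin exponential_pdf_ge0.
rewrite lte_mul_pinfty//.
apply: (@le_lt_trans _ _ (\int[mu]_x (exponential_pdf 4^-1 x)%:E)%E).
  apply: ge0_subset_integral => //.
    by apply/measurable_EFinP; exact: measurable_exponential_pdf.
  by move=> x _; rewrite lee_fin exponential_pdf_ge0.
by rewrite integral_exponential_pdf// ltry.
Qed.

End Step.

(** * Pointwise limit and domination of the step functions *)

Section Laplace.
Variable R : realType.
Local Notation lwt := (@lwt R).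
Local Notation wt := (@wt R).
Local Notation mode := (mode R).
Local Notation scale := (scale R).
Local Notation m n := ((mode n)%:R : R).
Implicit Types (n y : nat) (x : R).

(** With this factor the step functions converge to the normal density itself. *)
Definition nwt n y : R := normal_peak 1 * (wt n y / wt n (mode n)).

Lemma nwtE n y : nwt n y = normal_peak 1 * expR (lwt n y - lwt n (mode n)).
Proof. by rewrite /nwt !wt_exp expRB. Qed.

Lemma nwt_ge0 n y : 0 <= nwt n y.
Proof. by rewrite nwtE mulr_ge0 ?normal_peak_ge0 ?expR_ge0. Qed.

Lemma normal_pdf01E x : normal_pdf 0 1 x = normal_peak 1 * expR (- (x ^+ 2 / 2)) :> R.
Proof. by rewrite normal_pdfE// /normal_fun subr0 expr1n mulNr. Qed.

(** Since the mode is an integer, this is (y - m) / s for the index y of the cell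
    that contains x, as soon as this index is nonnegative. *)
Definition lattice_pt n x : R := (Num.floor (scale n * x))%:~R / scale n.

Lemma lattice_pt_near n x : (0 < n)%N -> `|lattice_pt n x - x| <= (scale n)^-1.
Proof.
move=> n0; have s0 := scale_gt0 R n0.
have /andP[] := floor_itv (scale n * x); rewrite intrD.
set f := (Num.floor _)%:~R => h1 h2.
have -> : lattice_pt n x - x = (f - scale n * x) / scale n.
  by rewrite /lattice_pt -/f; field; lra.
rewrite normrM normfV (gtr0_norm s0) ler_pdivrMr// mulVf ?gt_eqF//.
by rewrite ler_norml; apply/andP; split; lra.
Qed.

Lemma scaleV_cvg0 : (scale n)^-1 @[n --> \oo] --> (0 : R).
Proof.
apply/cvgrPdist_le => e e0; near=> n.
have n0 : (0 < n)%N by near: n; exact: nbhs_infty_gt.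
have s0 := scale_gt0 R n0.
have sV : 0 < (scale n)^-1 by rewrite invr_gt0.
have eV : 0 < e^-1 by rewrite invr_gt0.
have es : e^-1 <= scale n by near: n; exact: scale_ge.
rewrite sub0r normrN (gtr0_norm sV) -[leRHS]invrK.
by move: (scale n) s0 es {sV} => s s0 es; rewrite lef_pV2 ?posrE.
Unshelve. all: by end_near. Qed.

Lemma lattice_pt_cvg x : lattice_pt n x @[n --> \oo] --> x.
Proof.
apply/cvgrPdist_le => e e0; near=> n.
have n0 : (0 < n)%N by near: n; exact: nbhs_infty_gt.
rewrite distrC; apply: le_trans (lattice_pt_near _ n0) _.
near: n; have /cvgrPdist_le/(_ e e0) := scaleV_cvg0.
apply: filterS => n; apply: le_trans.
by rewrite sub0r normrN ler_norm.
Unshelve. all: by end_near. Qed.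

(** The index is eventually nonnegative because m / s >= s tends to infinity. *)
Lemma step_index x : \forall n \near \oo, exists y,
  [/\ (y%:R - m n) / scale n = lattice_pt n x,
      `|y%:R - m n| <= (`|x| + 1) * scale n &
      forall a, step a (mode n) (scale n) x = a y].
Proof.
near=> n.
have n0 : (0 < n)%N by near: n; exact: nbhs_infty_gt.
have s0 := scale_gt0 R n0.
have s1 : 1 <= scale n by near: n; exact: scale_ge.
have sx : `|x| + 1 <= scale n by near: n; exact: scale_ge.
have sm := scale_le_mode R n0.
have /andP[] := floor_itv (scale n * x); rewrite intrD.
set f := Num.floor _ => h1 h2.
have : - (scale n * `|x|) <= scale n * x <= scale n * `|x|.
  rewrite -mulrN !ler_pM2l// -ler_norml.
  by rewrite lexx.
case/andP => h3 h4.
have h5 : (`|x| + 1) * scale n <= m n.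
  by apply: le_trans sm; rewrite expr2 ler_pM2r.
have z0 : 0 <= (mode n)%:Z + f.
  rewrite -(ler_int R) intrD /=; rewrite -[(mode n)%:~R]/(m n).
  by lra.
have ye : (absz ((mode n)%:Z + f))%:R - m n = f%:~R :> R.
  rewrite -[_%:R]/((absz ((mode n)%:Z + f))%:Z%:~R) gez0_abs// intrD.
  by rewrite -[(mode n)%:~R]/(m n) addrAC subrr add0r.
exists (absz ((mode n)%:Z + f)); split; first by rewrite ye.
  by rewrite ye ler_norml; apply/andP; split; lra.
by move=> a; rewrite /step -/f z0.
Unshelve. all: by end_near. Qed.

Lemma step_nwt_cvg (g : nat -> R -> R) (l : R) x :
  g n (lattice_pt n x) @[n --> \oo] --> l ->
  step (fun y => nwt n y * g n ((y%:R - m n) / scale n)) (mode n) (scale n) x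
    @[n --> \oo] --> normal_pdf 0 1 x * l.
Proof.
move=> gl.
pose r n : R := ln (step (nwt n) (mode n) (scale n) x / normal_peak 1).
have p0 : 0 < normal_peak 1 :> R by rewrite normal_peak_gt0// oner_neq0.
have rc : r n + (lattice_pt n x) ^+ 2 / 2 @[n --> \oo] --> (0 : R).
  apply/cvgrPdist_le => e e0; near=> n.
  have n0 : (0 < n)%N by near: n; exact: nbhs_infty_gt.
  have s0 := scale_gt0 R n0.
  have [y [<- yK sE]] : exists y,
    [/\ (y%:R - m n) / scale n = lattice_pt n x,
        `|y%:R - m n| <= (`|x| + 1) * scale n &
        forall a, step a (mode n) (scale n) x = a y].
    by near: n; exact: step_index.
  rewrite /r sE nwtE [normal_peak 1 * _]mulrC mulfK ?gt_eqF//.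
  rewrite expRK sub0r normrN.
  have -> : ((y%:R - m n) / scale n) ^+ 2 / 2
      = (y%:R - m n) ^+ 2 / (2 * scale n ^+ 2) by field; lra.
  by move: y yK {sE}; near: n; apply: lwt_quadratic.
have lc2 : (lattice_pt n x) ^+ 2 / 2 @[n --> \oo] --> x ^+ 2 / 2.
  rewrite expr2; under eq_fun do rewrite expr2.
  by apply: cvgM; [apply: cvgM; exact: lattice_pt_cvg|exact: cvg_cst].
have rx : r n @[n --> \oo] --> - (x ^+ 2 / 2).
  rewrite -[- (x ^+ 2 / 2)]add0r.
  have h : r n + lattice_pt n x ^+ 2 / 2 - lattice_pt n x ^+ 2 / 2 @[n --> \oo]
      --> 0 - x ^+ 2 / 2 by exact: cvgB.
  move: h; apply: cvg_trans; apply: near_eq_cvg.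
  by apply: nearW => n; lra.
have h : normal_peak 1 * expR (r n) * g n (lattice_pt n x) @[n --> \oo]
    --> normal_peak 1 * expR (- (x ^+ 2 / 2)) * l.
  apply: cvgM => //; apply: cvgM; first exact: cvg_cst.
  by apply: continuous_cvg rx; exact: continuous_expR.
rewrite normal_pdf01E; move: h; apply: cvg_trans; apply: near_eq_cvg; near=> n.
have [y [ye _ sE]] : exists y,
  [/\ (y%:R - m n) / scale n = lattice_pt n x,
      `|y%:R - m n| <= (`|x| + 1) * scale n &
      forall a, step a (mode n) (scale n) x = a y].
  by near: n; exact: step_index.
rewrite /r !sE ye lnK; first by rewrite [normal_peak 1 * _]mulrC divfK ?gt_eqF.
by rewrite posrE divr_gt0// nwtE mulr_gt0 ?expR_gt0.
Unshelve. all: by end_near. Qed.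

(** Half of the exponential decay of the weights absorbs a factor of quadratic
    growth; the constant 100 is generous. *)
Lemma quad_le_expR (t : R) : 0 <= t -> 1 + (t + 1) ^+ 2 <= 100 * expR (t / 4).
Proof.
move=> t0; have := @expR_ge1Dxn R (t / 4) 1; rewrite divr_ge0// => /(_ isT).
rewrite expr_div_n (_ : 2`!%:R = 2 :> R)// => h.
have : 100 * (1 + t ^+ 2 / 4 ^+ 2 / 2) <= 100 * expR (t / 4).
  by rewrite ler_wpM2l.
by apply: le_trans; have := sqr_ge0 (t - 1); lra.
Qed.

(** A point x and the left end u of its cell differ by at most 1 / s <= 1, so that the
    bound exp (2 - |u| / 2) of lwt_tail is at most exp (3 - |x| / 2). *)
Lemma step_nwt_dominated (C : R) : 0 <= C -> \forall n \near \oo,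
  forall (g : R -> R), (forall u, 0 <= g u <= C * (1 + u ^+ 2)) -> forall x,
  0 <= step (fun y => nwt n y * g ((y%:R - m n) / scale n)) (mode n) (scale n) x
  <= normal_peak 1 * C * expR 3 * 100 * expR (- (`|x| / 4)).
Proof.
move=> C0; near=> n => g gC x.
have n0 : (0 < n)%N by near: n; exact: nbhs_infty_gt.
have s0 := scale_gt0 R n0.
have s1 : 1 <= scale n by near: n; exact: scale_ge.
have ht : forall y, lwt n y - lwt n (mode n) <= 2 - `|y%:R - m n| / (2 * scale n).
  by near: n; exact: lwt_tail.
have p0 : 0 <= normal_peak 1 :> R by exact: normal_peak_ge0.
have B0 : 0 <= normal_peak 1 * C * expR 3 * 100 * expR (- (`|x| / 4)).
  by rewrite !mulr_ge0// expR_ge0.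
have [[y _ xy]|out] := pselect ((\bigcup_y cell (mode n) (scale n) y) x); last first.
  by rewrite step_out// lexx.
rewrite (step_cell _ s0 xy).
have [g0 gu] : 0 <= g ((y%:R - m n) / scale n) /\
    g ((y%:R - m n) / scale n) <= C * (1 + ((y%:R - m n) / scale n) ^+ 2).
  by apply/andP.
rewrite mulr_ge0 ?nwt_ge0//=.
set u := (y%:R - m n) / scale n in g0 gu *.
have xu : `|x - u| <= 1.
  move: xy; rewrite /cell /= in_itv /= -/u => /andP[h1].
  rewrite -[y.+1%:R]natr1 addrAC mulrDl -/u mul1r => h2.
  have : (scale n)^-1 <= 1 by rewrite invf_le1.
  by move=> h3; rewrite ler_norml; apply/andP; split; lra.
have ux : `|u| <= `|x| + 1.
  have -> : u = x - (x - u) by lra.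
  by apply: le_trans (ler_normB _ _) _; rewrite lerD2l.
have xu' : `|x| <= `|u| + 1.
  have -> : x = u + (x - u) by lra.
  by apply: le_trans (ler_normD _ _) _; rewrite lerD2l.
have uE : `|y%:R - m n| / (2 * scale n) = `|u| / 2.
  by rewrite /u normrM normfV (gtr0_norm s0); field; lra.
have hn : nwt n y <= normal_peak 1 * (expR 3 * expR (- (`|x| / 2))).
  rewrite nwtE ler_wpM2l// -expRD ler_expR.
  by apply: le_trans (ht y) _; rewrite uE; lra.
have hg : g u <= C * (100 * expR (`|x| / 4)).
  apply: le_trans gu _; rewrite ler_wpM2l//.
  apply: le_trans (quad_le_expR (normr_ge0 x)); rewrite lerD2l.
  by rewrite -real_normK ?num_real// ler_sqr ?nnegrE// addr_ge0.
apply: le_trans (ler_pM (nwt_ge0 _ _) g0 hn hg) _.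
have -> : expR (- (`|x| / 4)) = expR (- (`|x| / 2)) * expR (`|x| / 4).
  by rewrite -expRD; congr expR; lra.
by rewrite le_eqVlt; apply/orP; left; apply/eqP; ring.
Unshelve. all: by end_near. Qed.

End Laplace.

(** * The Laplace method *)

Section LaplaceIntegral.
Variable R : realType.
Local Notation mu := (@lebesgue_measure R).
Local Notation mode := (mode R).
Local Notation scale := (scale R).
Local Notation m n := ((mode n)%:R : R).
Implicit Types (n y : nat) (x : R).

(** The point t is where a test function such as the indicator of a half line may
    fail to converge. *)
Lemma laplace_integral (g : nat -> R -> R) (h : R -> R) (t C : R) :
  (forall n u, 0 <= g n u <= C * (1 + u ^+ 2)) ->
  measurable_fun [set: R] h ->
  (forall x, x != t -> g n (lattice_pt n x) @[n --> \oo] --> h x) ->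
  mu.-integrable [set: R] (fun x => (normal_pdf 0 1 x * h x)%:E) /\
  (\sum_(y <oo) (nwt R n y * g n ((y%:R - m n) / scale n) / scale n)%:E)%E
    @[n --> \oo] --> (\int[mu]_x (normal_pdf 0 1 x * h x)%:E)%E.
Proof.
move=> gC mh gh.
have C0 : 0 <= C.
  have /andP[a b] := gC 0 0.
  by have := le_trans a b; rewrite expr0n addr0 mulr1.
have [N _ hN] := step_nwt_dominated C0.
pose st n x := step (fun y => nwt R n y * g n ((y%:R - m n) / scale n)) (mode n) (scale n) x.
pose B : R -> R := fun x => normal_peak 1 * C * expR 3 * 100 * expR (- (`|x| / 4)).
have sp n : 0 < scale (n + N.+1).
  by apply: scale_gt0; rewrite addnS.
have [] := @dominated_convergence _ _ _ mu [set: R] measurableT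
  (fun n x => (st (n + N.+1)%N x)%:E) (fun x => (normal_pdf 0 1 x * h x)%:E)
  (EFin \o B).
- by move=> n; apply/measurable_EFinP; exact: measurable_step.
- apply/measurable_EFinP; apply: measurable_funM => //.
  exact: measurable_normal_pdf.
- exists [set t]; split => //; first exact: lebesgue_measure_set1.
  move=> x /= nx; apply: contrapT => xt; apply: nx => _.
  have {}xt : x != t by apply/eqP.
  apply: cvg_EFin; first exact: nearW.
  have := step_nwt_cvg (gh x xt); rewrite -(cvg_shiftn N.+1).
  by apply: cvg_trans.
- have := @integrableZl _ _ _ mu _ measurableT
    (normal_peak 1 * C * expR 3 * 100) _ (integrable_expR_norm R).
  by apply: eq_integrable => // x _; rewrite /= -EFinM.
- apply: aeW => /= x n _; rewrite lee_fin.
  have Nn : (N <= n + N.+1)%N by rewrite addnS -addSn leq_addl.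
  have /andP[s0 sB] := hN _ Nn (g (n + N.+1)%N) (gC _) x.
  by rewrite ger0_norm.
move=> inth _ cv; split=> //.
rewrite -(cvg_shiftn N.+1); apply: cvg_trans cv.
apply: near_eq_cvg; apply: nearW => n /=.
rewrite integral_step => [|//|y]; first by [].
have /andP[g0 _] := gC (n + N.+1)%N ((y%:R - m (n + N.+1)) / scale (n + N.+1)).
by rewrite mulr_ge0 ?nwt_ge0.
Qed.

Lemma integral_normal_pdf1 : (\int[mu]_x (normal_pdf 0 1 x * 1)%:E = 1%E)%E.
Proof.
under eq_integral do rewrite mulr1.
exact: integral_normal_pdf.
Qed.

Lemma is_derive_normal_pdf x :
  is_derive x 1 (fun x : R => normal_pdf 0 1 x) (- x * normal_pdf 0 1 x).
Proof.
have -> : (fun x : R => normal_pdf 0 1 x) =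
    normal_peak 1 *: (expR \o (- (2^-1 *: (@id R) ^+ 2))).
  apply/funext => y; rewrite normal_pdf01E /=; congr (_ * expR _).
  by rewrite !fctE /= mulrC.
apply: is_derive_eq; rewrite normal_pdf01E.
have -> : (- (2^-1 *: (@id R) ^+ 2)) x = - (x ^+ 2 / 2).
  by rewrite !fctE /= mulrC.
by rewrite /GRing.scale /= expr1; field.
Qed.

Lemma normal_pdf_decay x : 0 < x -> x * normal_pdf 0 1 x <= 2 * normal_peak 1 / x.
Proof.
move=> x0; have p0 : 0 <= normal_peak 1 :> R by exact: normal_peak_ge0.
have -> : 2 * normal_peak 1 / x = normal_peak 1 * (2 / x) by field; lra.
rewrite normal_pdf01E mulrCA ler_wpM2l//.
rewrite expRN ler_pdivrMr ?expR_gt0//.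
have := expR_ge1Dx (x ^+ 2 / 2 : R) => h.
apply: (@le_trans _ _ (2 / x * (x ^+ 2 / 2))).
  by rewrite le_eqVlt; apply/orP; left; apply/eqP; field; lra.
by rewrite ler_wpM2l ?divr_ge0 ?ltW//; lra.
Qed.

Lemma integral_itv_cvg (f : R -> R) : mu.-integrable [set: R] (EFin \o f) ->
  (\int[mu]_(x in `[(- k.+1%:R)%R, (k.+1%:R)%R]) (f x)%:E)%E @[k --> \oo]
    --> (\int[mu]_x (f x)%:E)%E.
Proof.
move=> fi; have mf := measurable_int _ fi.
pose I k : set R := `[- k.+1%:R, k.+1%:R]%classic.
have [] := @dominated_convergence _ _ _ mu [set: R] measurableT
  (fun k => (EFin \o f) \_ (I k)) (EFin \o f) (fun x => `|(f x)%:E|%E).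
- move=> k; apply/measurable_restrict => //; first exact: measurable_itv.
  exact: (measurable_funTS mf).
- exact: mf.
- apply: aeW => x _; apply: cvg_near_cst; near=> k.
  rewrite patchE mem_set//= /I /= in_itv /= -ler_norml.
  apply: (@le_trans _ _ k%:R); last by rewrite ler_nat.
  by near: k; exact: nbhs_infty_ger.
- exact: integrable_abse.
- apply: aeW => x k _; rewrite patchE; case: ifP => _ //=.
  by rewrite normr0 lee_fin normr_ge0.
move=> _ _; apply: cvg_trans; apply: near_eq_cvg; apply: nearW => k /=.
by rewrite -integral_mkcond.
Unshelve. all: by end_near. Qed.

(** The integrand is the derivative of - (x + c) * normal_pdf 0 1 x, which vanishes
    at infinity. *)
Lemma integral_hermite (c : R) :
  mu.-integrable [set: R] (fun x => (normal_pdf 0 1 x * (x ^+ 2 + c * x - 1))%:E) ->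
  (\int[mu]_x (normal_pdf 0 1 x * (x ^+ 2 + c * x - 1))%:E = 0)%E.
Proof.
move=> fi.
set f := fun x : R => normal_pdf 0 1 x * (x ^+ 2 + c * x - 1).
pose F : R -> R := fun x => - (x + c) * normal_pdf 0 1 x.
have dF x : is_derive x 1 F (f x).
  have h := is_derive_normal_pdf x.
  have -> : F = (- (id + cst c)) * (fun x : R => normal_pdf 0 1 x) by [].
  apply: is_derive_eq; rewrite /f /GRing.scale /= !fctE /=; ring.
have cphi : continuous (fun x : R => normal_pdf 0 1 x).
  by apply: continuous_normal_pdf; exact: oner_neq0.
have cf : continuous f.
  move=> x; apply: cvgM; first exact: cphi.
  apply: cvgB; last exact: cvg_cst.
  apply: cvgD; first exact: exprn_continuous.
  by apply: cvgM; [exact: cvg_cst|exact: cvg_id].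
have cF : continuous F.
  move=> x; apply: differentiable_continuous; apply/derivable1_diffP.
  exact: ex_derive.
have FE k : (\int[mu]_(x in `[(- k.+1%:R)%R, (k.+1%:R)%R]) (f x)%:E)%E
    = (- (2 * (k.+1%:R * normal_pdf 0 1 (k.+1%:R : R))))%:E.
  rewrite (@continuous_FTC2 _ f F).
  - rewrite -EFinB /F; congr EFin.
    have -> : normal_pdf 0 1 (- k.+1%:R) = normal_pdf 0 1 (k.+1%:R : R) :> R.
      by rewrite !normal_pdf01E sqrrN.
    by lra.
  - by rewrite lt_neqAle -subr_ge0 opprK; have : 0 < k.+1%:R :> R by []; lra.
  - by apply: continuous_subspaceT => x; exact: cf.
  - split.
    + by move=> x _; exact: ex_derive.
    + by apply: cvg_at_right_filter; exact: cF.
    + by apply: cvg_at_left_filter; exact: cF.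
  - by move=> x _; rewrite derive1E derive_val.
have := integral_itv_cvg fi.
suff : (\int[mu]_(x in `[(- k.+1%:R)%R, (k.+1%:R)%R]) (f x)%:E)%E @[k --> \oo] --> 0%E.
  by move=> h1 h2; apply/esym; apply: cvg_unique h1 h2 => //; exact: ereal_hausdorff.
under eq_fun do rewrite FE.
apply: cvg_EFin; first exact: nearW.
apply/cvgrPdist_le => e e0; near=> k.
have p0 : 0 <= normal_peak 1 :> R by exact: normal_peak_ge0.
have k0 : 0 < k.+1%:R :> R by [].
have := normal_pdf_decay k0.
rewrite sub0r opprK ger0_norm; last by rewrite !mulr_ge0// normal_pdf_ge0.
move=> h; apply: (@le_trans _ _ (2 * (2 * normal_peak 1 / k.+1%:R))).
  by rewrite ler_wpM2l.
rewrite mulrA ler_pdivrMr// [e * _]mulrC -ler_pdivrMr//.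
apply: (@le_trans _ _ k%:R); last by rewrite ler_nat.
by near: k; exact: nbhs_infty_ger.
Unshelve. all: by end_near. Qed.

End LaplaceIntegral.

(** * Series and the convolution with the Poisson law *)

Section Sums.
Variable R : realType.
Implicit Types (f g : nat -> R) (l : R) (k j y n : nat).

Definition sums_to f l := series f @ \oo --> l.

Lemma sums_to_ext f g l : f =1 g -> sums_to f l -> sums_to g l.
Proof. by move=> /funext ->. Qed.

Lemma sums_toD f g l l' : sums_to f l -> sums_to g l' ->
  sums_to (fun j => f j + g j) (l + l').
Proof.
move=> h h'; rewrite /sums_to.
have -> : series (fun j => f j + g j) = series f \+ series g.
  by apply/funext => N; rewrite /series /= big_split.
exact: cvgD.
Qed.

Lemma sums_toZ (c : R) f l : sums_to f l -> sums_to (fun j => c * f j) (c * l).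
Proof.
move=> h; rewrite /sums_to.
have -> : series (fun j => c * f j) = (fun N => c * series f N).
  by apply/funext => N; rewrite /series /= mulr_sumr.
by apply: cvgM => //; exact: cvg_cst.
Qed.

Lemma sums_to_sum (I : finType) (F : I -> nat -> R) (L : I -> R) :
  (forall i, sums_to (F i) (L i)) -> sums_to (fun j => \sum_i F i j) (\sum_i L i).
Proof.
move=> h; rewrite /sums_to.
have -> : series (fun j => \sum_i F i j) = (fun N => \sum_i series (F i) N).
  by apply/funext => N; rewrite /series /= exchange_big.
by apply: cvg_big => [|i _]; [exact: add_continuous|exact: h].
Qed.

Lemma sums_to_shift f l k : sums_to f l ->
  sums_to (fun y => if (k <= y)%N then f (y - k)%N else 0) l.
Proof.
move=> h; rewrite /sums_to -(cvg_shiftn k).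
apply: cvg_trans h; apply: near_eq_cvg; apply: nearW => N /=.
rewrite /series /= addnC [RHS](big_cat_nat (n := k))//= ?leq_addr//.
rewrite [X in _ = X + _]big_nat [X in _ = X + _]big1 ?add0r => [|i /andP[_ ik]].
  rewrite -{1}[k]add0n big_addn addKn.
  by apply: eq_bigr => i _; rewrite leq_addl addnK.
by rewrite leqNgt ik.
Qed.

Lemma sums_to_le f g l l' : (forall j, f j <= g j) ->
  sums_to f l -> sums_to g l' -> l <= l'.
Proof.
move=> fg h h'; apply: ler_cvg_to h h' _.
by apply: nearW => N; apply: ler_sum => i _.
Qed.

Lemma sums_to_ge f l N : (forall j, 0 <= f j) -> sums_to f l -> series f N <= l.
Proof.
move=> f0 h; have c : cvgn (series f) by apply/cvg_ex; exists l.
rewrite -(cvg_lim _ h)//; apply: nondecreasing_cvgn_le => //.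
by apply/nondecreasing_seqP => i; rewrite /series /= big_nat_recr//= lerDl.
Qed.

Lemma sums_to_ex f g : (forall j, 0 <= f j <= g j) -> cvgn (series g) ->
  exists l, sums_to f l.
Proof.
move=> fg cg; have : cvgn (series f).
  apply: series_le_cvg cg => j; have /andP[a b] := fg j => //.
  exact: le_trans b.
by move/cvg_ex.
Qed.

Lemma eseries_sums_to f l : sums_to f l -> (\sum_(y <oo) (f y)%:E = l%:E)%E.
Proof.
move=> h; apply/cvg_lim => //.
have -> : (fun N => (\sum_(0 <= i < N) (f i)%:E)%E) = EFin \o series f.
  by apply/funext => N /=; rewrite sumEFin.
by apply: cvg_EFin => //; exact: nearW.
Qed.

(** The masses of the Poisson law of mean 1 / 2, without the factor exp (- 1 / 2). *)
Definition pois j : R := ((2 ^ j * j`!)%:R)^-1.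

Lemma pois_gt0 j : 0 < pois j.
Proof. by rewrite invr_gt0 ltr0n muln_gt0 expn_gt0 fact_gt0. Qed.

Lemma sqr_le_fact j : (j ^ 2 <= 2 * j`!)%N.
Proof.
case: j => [|[|[|j]]] //.
have h : (j.+3 <= 2 * j.+2)%N by lia.
rewrite factS mulnCA leq_mul2l /=; apply: leq_trans h _.
by rewrite leq_mul2l /= factS -[X in (X <= _)%N]muln1 leq_mul// fact_gt0.
Qed.

(** Z has a second moment: the series is dominated by a geometric one. *)
Lemma pois_moment_ex i : (i <= 2)%N -> exists l, sums_to (fun j => pois j * j%:R ^+ i) l.
Proof.
move=> i2; apply: (@sums_to_ex _ (geometric 2 (2^-1))); last first.
  by apply: is_cvg_geometric_series; rewrite ger0_norm ?invr_ge0// invf_lt1 ?ltr1n.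
move=> j; rewrite mulr_ge0 ?(ltW (pois_gt0 j)) ?exprn_ge0//=.
have -> : 2 * 2^-1 ^+ j = pois j * (2 * (j`!)%:R) :> R.
  have h1 : (2 ^+ j : R) != 0 by rewrite expf_neq0.
  have h2 : (j`!)%:R != 0 :> R by rewrite pnatr_eq0 -lt0n fact_gt0.
  by rewrite /pois natrM natrX exprVn; field; rewrite h1 h2.
rewrite ler_wpM2l ?(ltW (pois_gt0 j))//.
rewrite -natrX -natrM ler_nat; case: j => [|j]; first by case: i i2 => [|[]].
by apply: leq_trans (sqr_le_fact j.+1); rewrite leq_pexp2l.
Qed.

Definition pois_moment i : R := limn (series (fun j => pois j * j%:R ^+ i)).

Lemma pois_momentP i : (i <= 2)%N -> sums_to (fun j => pois j * j%:R ^+ i) (pois_moment i).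
Proof. by move=> /pois_moment_ex[l h]; rewrite /pois_moment (cvg_lim _ h). Qed.

(** Since y^_k / y! = 1 / (y - k)!, each term of odd_power_sum becomes a Poisson mass
    shifted by k. *)
Lemma wt_mixture n y : wt R n y =
  \sum_(p : bnpart n) (if (#|block_pairs p| <= y)%N then pois (y - #|block_pairs p|) else 0).
Proof.
rewrite /wt -natrX odd_power_sum natr_sum mulr_suml; apply: eq_bigr => p _.
set k := #|block_pairs p|; case: leqP => [ky|yk]; last by rewrite ffact_small ?mul0r.
rewrite /pois -(ffact_fact ky) (_ : 2 ^ y = 2 ^ (y - k) * 2 ^ k)%N; last by rewrite -expnD subnK.
have h1 : (2 ^ k)%:R != 0 :> R by rewrite pnatr_eq0 expn_eq0.
have h2 : (y ^_ k)%:R != 0 :> R by rewrite pnatr_eq0 -lt0n ffact_gt0.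
have h3 : (2 ^ (y - k))%:R != 0 :> R by rewrite pnatr_eq0 expn_eq0.
have h4 : ((y - k)`!)%:R != 0 :> R by rewrite pnatr_eq0 -lt0n fact_gt0.
rewrite !natrM; move: (2 ^ k)%:R (y ^_ k)%:R (2 ^ (y - k))%:R (y - k)`!%:R h1 h2 h3 h4.
by move=> a b c d h1 h2 h3 h4; field; rewrite h1 h2 h3 h4.
Qed.

(** The expectation of g (xi_n + Z), computed by conditioning on the partition. *)
Lemma mixture_sum n g (L : nat -> R) :
  (forall k, sums_to (fun j => pois j * g (k + j)%N) (L k)) ->
  sums_to (fun y => wt R n y * g y) (\sum_(p : bnpart n) L #|block_pairs p|).
Proof.
move=> h.
apply: (@sums_to_ext (fun y => \sum_(p : bnpart n)
  (if (#|block_pairs p| <= y)%N then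
    pois (y - #|block_pairs p|) * g (#|block_pairs p| + (y - #|block_pairs p|))%N else 0))).
  move=> y; rewrite wt_mixture mulr_suml; apply: eq_bigr => p _.
  by case: leqP => ky; rewrite ?subnKC// mul0r.
apply: sums_to_sum => p.
exact: (@sums_to_shift (fun j => pois j * g (#|block_pairs p| + j)%N)).
Qed.

Lemma laplace_sums (g : nat -> R -> R) (h : R -> R) (t C l : R) (A : nat -> R) :
  (forall n u, 0 <= g n u <= C * (1 + u ^+ 2)) ->
  measurable_fun [set: R] h ->
  (forall x, x != t -> g n (lattice_pt n x) @[n --> \oo] --> h x) ->
  (\int[lebesgue_measure]_x (normal_pdf 0 1 x * h x)%:E = l%:E)%E ->
  (forall n, sums_to (fun y => wt R n y *
     g n ((y%:R - (mode R n)%:R) / scale R n)) (A n)) ->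
  normal_peak 1 / (wt R n (mode R n) * scale R n) * A n @[n --> \oo] --> l.
Proof.
move=> gC mh gh il hA.
have [_] := laplace_integral gC mh gh; rewrite il => /fine_cvg.
apply: cvg_trans; apply: near_eq_cvg; apply: nearW => n /=.
rewrite (@eseries_sums_to _
  (normal_peak 1 / (wt R n (mode R n) * scale R n) * A n))//.
apply: (@sums_to_ext _ _ _ _ (@sums_toZ _ _ _ (hA n))) => y /=.
by rewrite /nwt invfM; ring.
Qed.

End Sums.

(** * Mean and variance of the number of block pairs *)

Section Moments.
Variable R : realType.
Implicit Types (n j k : nat).
Local Notation mu := (@lebesgue_measure R).
Local Notation M i := (pois_moment R i).
Local Notation m n := ((mode R n)%:R : R).
Local Notation s n := (scale R n).

Lemma sqr_shift_le (c u : R) : 0 <= (u + c) ^+ 2 <= (2 + 2 * c ^+ 2) * (1 + u ^+ 2).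
Proof.
rewrite sqr_ge0 /=; have := sqr_ge0 (u - c).
have : 0 <= c ^+ 2 * u ^+ 2 by rewrite mulr_ge0 ?sqr_ge0.
by lra.
Qed.

Lemma measurable_sqr_shift (c : R) : measurable_fun [set: R] (fun x : R => (x + c) ^+ 2).
Proof. by apply: measurable_funX; exact: measurable_funD. Qed.

Lemma cvg_sqr_shift (c x : R) (u : nat -> R) : u n @[n --> \oo] --> x ->
  (u n + c) ^+ 2 @[n --> \oo] --> (x + c) ^+ 2.
Proof.
move=> ux; rewrite expr2; under eq_fun do rewrite expr2.
by apply: cvgM; (apply: cvgD; [exact: ux|exact: cvg_cst]).
Qed.

(** (x + c)^2 is 1 + c^2 plus the polynomial of integral_hermite. *)
Lemma integral_sqr_shift (c : R) :
  (\int[mu]_x (normal_pdf 0 1 x * (x + c) ^+ 2)%:E = (1 + c ^+ 2)%:E)%E.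
Proof.
have [si _] := @laplace_integral R (fun _ u => (u + c) ^+ 2) (fun x => (x + c) ^+ 2)
  0 _ (fun _ => sqr_shift_le c) (measurable_sqr_shift c)
  (fun x _ => @cvg_sqr_shift c x _ (@lattice_pt_cvg R x)).
have ni : mu.-integrable [set: R] (fun x => ((1 + c ^+ 2)%:E * (normal_pdf 0 1 x)%:E)%E).
  by apply: integrableZl => //; exact: integrable_normal_pdf.
have hi : mu.-integrable [set: R]
    (fun x => (normal_pdf 0 1 x * (x ^+ 2 + (2 * c) * x - 1))%:E).
  have := integrableB measurableT si ni; apply: eq_integrable => // x _.
  by rewrite -EFinM -EFinB; congr EFin; ring.
have h0 := integral_hermite hi.
transitivity (\int[mu]_x ((normal_pdf 0 1 x * (x ^+ 2 + (2 * c) * x - 1))%:E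
   + ((1 + c ^+ 2)%:E * (normal_pdf 0 1 x)%:E)))%E.
  by apply: eq_integral => x _; rewrite -EFinM -EFinD; congr EFin; ring.
rewrite integralD// h0 add0e integralZl//; last exact: integrable_normal_pdf.
by rewrite integral_normal_pdf mule1.
Qed.

Definition npart n : R := #|{: bnpart n}|%:R.
Definition mean_pairs n : R := (\sum_(p : bnpart n) #|block_pairs p|%:R) / npart n.
Definition var_pairs n : R :=
  (\sum_(p : bnpart n) (#|block_pairs p|%:R - mean_pairs n) ^+ 2) / npart n.

Lemma npart_gt0 n : 0 < npart n.
Proof. by rewrite ltr0n; apply/card_gt0P; exists (BnPart (is_bnpart_singletons n)). Qed.

Lemma pois_sum : sums_to (pois R) (M 0).
Proof. by apply: sums_to_ext (@pois_momentP R 0 isT) => j; rewrite mulr1. Qed.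

Lemma pois_moment0_gt0 : 0 < M 0.
Proof.
have := sums_to_ge 1 (fun j => ltW (pois_gt0 R j)) pois_sum.
by rewrite /series /= big_nat1; apply: lt_le_trans; exact: pois_gt0.
Qed.

Lemma pois_quadratic (a b : R) :
  sums_to (fun j => pois R j * (a + b * j%:R) ^+ 2)
    (a ^+ 2 * M 0 + (2 * a * b) * M 1 + b ^+ 2 * M 2).
Proof.
have h0 := @sums_toZ R (a ^+ 2) _ _ (@pois_momentP R 0 isT).
have h1 := @sums_toZ R (2 * a * b) _ _ (@pois_momentP R 1 isT).
have h2 := @sums_toZ R (b ^+ 2) _ _ (@pois_momentP R 2 isT).
apply: sums_to_ext (sums_toD (sums_toD h0 h1) h2) => j.
by rewrite expr0 expr1; ring.
Qed.

Lemma sum_dev n : \sum_(p : bnpart n) (#|block_pairs p|%:R - mean_pairs n) = 0.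
Proof.
rewrite sumrB sumr_const -[_ *+ #|_|]mulr_natr /mean_pairs divfK ?subrr//.
by rewrite gt_eqF ?npart_gt0.
Qed.

Lemma sum_sqr_dev n (a b : R) :
  \sum_(p : bnpart n) ((#|block_pairs p|%:R - a) * b) ^+ 2
  = npart n * (var_pairs n * b ^+ 2 + ((mean_pairs n - a) * b) ^+ 2).
Proof.
transitivity (\sum_(p : bnpart n) (b ^+ 2 * (#|block_pairs p|%:R - mean_pairs n) ^+ 2
   + 2 * b ^+ 2 * (mean_pairs n - a) * (#|block_pairs p|%:R - mean_pairs n)
   + ((mean_pairs n - a) * b) ^+ 2)).
  by apply: eq_bigr => p _; ring.
rewrite !big_split /= -!mulr_sumr sum_dev mulr0 addr0 sumr_const -[_ *+ #|_|]mulr_natr.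
have -> : \sum_(p : bnpart n) (#|block_pairs p|%:R - mean_pairs n) ^+ 2
    = npart n * var_pairs n.
  by rewrite /var_pairs mulrC divfK// gt_eqF ?npart_gt0.
by rewrite -/(npart n); ring.
Qed.

Lemma sum_dev_lin n (a b : R) :
  \sum_(p : bnpart n) ((#|block_pairs p|%:R - a) * b)
  = npart n * ((mean_pairs n - a) * b).
Proof.
rewrite -mulr_suml sumrB sumr_const -[_ *+ #|_|]mulr_natr -/(npart n).
have -> : \sum_(p : bnpart n) #|block_pairs p|%:R = npart n * mean_pairs n.
  by rewrite /mean_pairs mulrC divfK// gt_eqF ?npart_gt0.
by ring.
Qed.

(** The inverse of the asymptotic total mass of the weights, see wnorm_total. *)
Definition wnorm n : R := normal_peak 1 / (wt R n (mode R n) * s n).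

Lemma wnorm_total : wnorm n * (npart n * M 0) @[n --> \oo] --> (1 : R).
Proof.
apply: (@laplace_sums R (fun _ _ => 1) (cst 1) 0 1) => //.
- by move=> _ u; rewrite ler01 mul1r lerDl sqr_ge0.
- by move=> x _; exact: cvg_cst.
- exact: integral_normal_pdf1.
move=> n; have := @mixture_sum R n (fun=> 1) (fun=> M 0).
rewrite sumr_const -[_ *+ #|_|]mulr_natl; apply => k.
by apply: sums_to_ext pois_sum => j; rewrite mulr1.
Qed.

(** The position of the mean of xi_n relative to the mode, in units of the width. *)
Definition qmean n : R := (mean_pairs n - m n) / s n.

Lemma mixture_quadratic (c : R) n :
  sums_to (fun y => wt R n y * ((y%:R - m n) / s n + c) ^+ 2)
    (npart n * ((var_pairs n / s n ^+ 2 + (qmean n + c) ^+ 2) * M 0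
      + 2 * (qmean n + c) / s n * M 1 + (s n) ^- 2 * M 2)).
Proof.
pose a k := (k%:R - m n) / s n + c.
have := @mixture_sum R n (fun y => ((y%:R - m n) / s n + c) ^+ 2)
  (fun k => a k ^+ 2 * M 0 + (2 * a k * (s n)^-1) * M 1 + (s n)^-1 ^+ 2 * M 2).
set T := \sum_p _; set T' := npart n * _; suff -> : T = T'.
  apply => k. refine (sums_to_ext _ (@pois_quadratic (a k) (s n)^-1)) => j.
  by rewrite natrD /a; congr (_ * _ ^+ 2); ring.
rewrite /T /T' /a.
transitivity (\sum_(p : bnpart n)
   (M 0 * ((#|block_pairs p|%:R - m n) * (s n)^-1) ^+ 2
    + (2 * c * M 0 + 2 * (s n)^-1 * M 1) * ((#|block_pairs p|%:R - m n) * (s n)^-1)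
    + (c ^+ 2 * M 0 + 2 * c * (s n)^-1 * M 1 + (s n)^-1 ^+ 2 * M 2))).
  by apply: eq_bigr => p _; ring.
rewrite !big_split /= -!mulr_sumr sum_sqr_dev sum_dev_lin !sumr_const.
rewrite -[M 0 *+ _]mulr_natr -[M 1 *+ _]mulr_natr -[M 2 *+ _]mulr_natr -/(npart n) -exprVn /qmean.
by ring.
Qed.

(** The second moment of (xi_n + Z - m) / s about - c. The terms with M 1 and M 2
    are those of Z; they disappear in the limit, and the cases c = 0 and c = 1
    determine the first two moments of xi_n. *)
Lemma quadratic_limit (c : R) :
  (var_pairs n / s n ^+ 2 + (qmean n + c) ^+ 2)
      + 2 * (qmean n + c) / s n * (M 1 / M 0) + (s n) ^- 2 * (M 2 / M 0)
    @[n --> \oo] --> 1 + c ^+ 2.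
Proof.
have M0 := pois_moment0_gt0.
have lim := @laplace_sums R (fun _ u => (u + c) ^+ 2) (fun x => (x + c) ^+ 2) 0
  _ _ _ (fun _ => sqr_shift_le c) (measurable_sqr_shift c)
  (fun x _ => @cvg_sqr_shift c x _ (@lattice_pt_cvg R x)) (integral_sqr_shift c)
  (@mixture_quadratic c).
have h : wnorm n * (npart n * ((var_pairs n / s n ^+ 2 + (qmean n + c) ^+ 2) * M 0
      + 2 * (qmean n + c) / s n * M 1 + (s n) ^- 2 * M 2))
    * (wnorm n * (npart n * M 0))^-1 @[n --> \oo] --> (1 + c ^+ 2) * 1^-1.
  by apply: cvgM => //; apply: cvgV; [exact: oner_neq0|exact: wnorm_total].
rewrite invr1 mulr1 in h; move: h; apply: cvg_trans; apply: near_eq_cvg.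
near=> n.
have n0 : (0 < n)%N by near: n; exact: nbhs_infty_gt.
have N0 := npart_gt0 n; have s0 := scale_gt0 R n0.
have w0 : 0 < wnorm n.
  by rewrite divr_gt0 ?mulr_gt0 ?wt_gt0 ?normal_peak_gt0// oner_neq0.
move: (wnorm n) (npart n) w0 N0 M0 => w N w0 N0 M0.
move: (var_pairs n / s n ^+ 2 + _) => A; move: (2 * (qmean n + c) / s n) (s n ^- 2) => B D.
move: (M 0) (M 1) (M 2) M0 => a0 a1 a2 M0.
by field; rewrite !gt_eqF.
Unshelve. all: by end_near. Qed.

End Moments.

Section Limit.
Variable R : realType.
Implicit Types (n j k : nat).
Local Notation mu := (@lebesgue_measure R).
Local Notation M i := (pois_moment R i).
Local Notation m n := ((mode R n)%:R : R).
Local Notation s n := (scale R n).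

Lemma qmean_cvg0 : qmean R n @[n --> \oo] --> (0 : R).
Proof.
have l0 := @quadratic_limit R 0.
have l1 := @quadratic_limit R 1.
have sV := @scaleV_cvg0 R.
have h : 2^-1 * (((var_pairs R n / s n ^+ 2 + (qmean R n + 1) ^+ 2)
      + 2 * (qmean R n + 1) / s n * (M 1 / M 0) + (s n) ^- 2 * (M 2 / M 0))
   - ((var_pairs R n / s n ^+ 2 + (qmean R n + 0) ^+ 2)
      + 2 * (qmean R n + 0) / s n * (M 1 / M 0) + (s n) ^- 2 * (M 2 / M 0)) - 1
   - 2 * (M 1 / M 0) * (s n)^-1) @[n --> \oo]
   --> 2^-1 * ((1 + 1 ^+ 2) - (1 + 0 ^+ 2) - 1 - 2 * (M 1 / M 0) * 0).
  apply: cvgM; first exact: cvg_cst.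
  apply: cvgB; last by apply: cvgM => //; exact: cvg_cst.
  by apply: cvgB; [exact: cvgB|exact: cvg_cst].
have e : 2^-1 * ((1 + 1 ^+ 2) - (1 + 0 ^+ 2) - 1 - 2 * (M 1 / M 0) * 0) = 0 :> R.
  by rewrite expr1n expr0n /=; lra.
rewrite e in h; move: h; apply: cvg_trans; apply: near_eq_cvg; apply: nearW => n.
rewrite addr0 -!exprVn; move: (M 1 / M 0) (M 2 / M 0) (s n)^-1 => a b d.
by field.
Qed.

Lemma var_scale_cvg : var_pairs R n / s n ^+ 2 @[n --> \oo] --> (1 : R).
Proof.
have l0 := @quadratic_limit R 0.
have sV := @scaleV_cvg0 R.
have q0 := qmean_cvg0.
have h : ((var_pairs R n / s n ^+ 2 + (qmean R n + 0) ^+ 2)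
      + 2 * (qmean R n + 0) / s n * (M 1 / M 0) + (s n) ^- 2 * (M 2 / M 0))
   - qmean R n * qmean R n - 2 * qmean R n * (s n)^-1 * (M 1 / M 0)
   - (s n)^-1 * (s n)^-1 * (M 2 / M 0) @[n --> \oo]
   --> (1 + 0 ^+ 2) - 0 * 0 - 2 * 0 * 0 * (M 1 / M 0) - 0 * 0 * (M 2 / M 0).
  apply: cvgB; last by apply: cvgM; [exact: cvgM|exact: cvg_cst].
  apply: cvgB; first by apply: cvgB => //; exact: cvgM.
  apply: cvgM; last exact: cvg_cst.
  by apply: cvgM => //; apply: cvgM => //; exact: cvg_cst.
have e : (1 + 0 ^+ 2) - 0 * 0 - 2 * 0 * 0 * (M 1 / M 0) - 0 * 0 * (M 2 / M 0) = 1 :> R.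
  by rewrite expr0n /=; lra.
rewrite e in h; move: h; apply: cvg_trans; apply: near_eq_cvg; apply: nearW => n.
by rewrite addr0 -!exprVn; ring.
Qed.

Lemma sqrt_var_cvg : Num.sqrt (var_pairs R n) / s n @[n --> \oo] --> (1 : R).
Proof.
have h : Num.sqrt (var_pairs R n / s n ^+ 2) @[n --> \oo] --> (Num.sqrt 1 : R).
  by apply: continuous_cvg var_scale_cvg; exact: sqrt_continuous.
rewrite sqrtr1 in h; move: h; apply: cvg_trans; apply: near_eq_cvg; near=> n.
have n0 : (0 < n)%N by near: n; exact: nbhs_infty_gt.
have s0 := scale_gt0 R n0.
rewrite sqrtrM; last first.
  by rewrite divr_ge0 ?(ltW (npart_gt0 _ _))// sumr_ge0// => p _; rewrite sqr_ge0.
by rewrite -exprVn sqrtr_sqr gtr0_norm// invr_gt0; exact: s0.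
Unshelve. all: by end_near. Qed.

(** * The distribution function *)
Definition normal_cdf (x : R) : R := fine (normal_prob (0 : R) 1 `]-oo, x]).

Lemma normal_cdfE x :
  (\int[mu]_y (normal_pdf 0 1 y * \1_(`]-oo, x] : set R) y)%:E = (normal_cdf x)%:E)%E.
Proof.
rewrite /normal_cdf fineK; last exact: fin_num_measure.
rewrite /normal_prob [RHS]integral_mkcond; apply: eq_integral => y _.
by rewrite patchE indicE; case: ifP => _; rewrite ?mulr1 ?mulr0.
Qed.

Definition cdf_count n (c : R) : R :=
  #|[pred p : bnpart n | (#|block_pairs p|%:R - m n) / s n <= c]|%:R.

(** The probability that k + Z lies below the level c after centring at the mode and
    scaling, up to the factor exp (- 1 / 2). *)
Definition pois_cut n (c : R) k : R :=
  limn (series (fun j => pois R j * (((k + j)%:R - m n) / s n <= c)%R%:R)).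

Lemma pois_cutP n c k :
  sums_to (fun j => pois R j * (((k + j)%:R - m n) / s n <= c)%R%:R) (pois_cut n c k).
Proof.
have [||l h] := @sums_to_ex R (fun j => pois R j * (((k + j)%:R - m n) / s n <= c)%R%:R) (pois R).
- move=> j; rewrite mulr_ge0 ?(ltW (pois_gt0 _ _))//=.
  by rewrite ler_piMr ?(ltW (pois_gt0 _ _))// lern1 leq_b1.
- by apply/cvg_ex; exists (M 0); exact: pois_sum.
by rewrite /pois_cut (cvg_lim _ h).
Qed.

Lemma cdf_count_sum n c : cdf_count n c =
  \sum_(p : bnpart n) ((#|block_pairs p|%:R - m n) / s n <= c)%R%:R.
Proof.
rewrite /cdf_count -sum1_card natr_sum big_mkcond /=.
by apply: eq_bigr => p _; rewrite inE; case: ifP.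
Qed.

(** Z is nonnegative. *)
Lemma pois_cut_ub n c k : (0 < n)%N ->
  pois_cut n c k <= M 0 * ((k%:R - m n) / s n <= c)%R%:R.
Proof.
move=> n0; have s0 := scale_gt0 R n0.
have h : sums_to (fun j => pois R j * ((k%:R - m n) / s n <= c)%R%:R)
    (M 0 * ((k%:R - m n) / s n <= c)%R%:R).
  set b : R := _%:R; have := @sums_toZ R b _ _ (@pois_sum R).
  by rewrite mulrC; apply: sums_to_ext => j; rewrite mulrC.
have P := @pois_cutP n c k.
refine (@sums_to_le R _ _ _ _ _ P h) => j.
rewrite ler_wpM2l ?(ltW (pois_gt0 _ _))//.
case: (leP ((k%:R - m n) / s n) c) => kc; first by rewrite lern1 leq_b1.
rewrite [_ <= c]leNgt (lt_le_trans kc)//.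
have sV : 0 < (s n)^-1 by rewrite invr_gt0.
by rewrite (ler_pM2r sV) lerD2r ler_nat leq_addr.
Qed.

(** If k lies below the level c and Z < J, then k + Z lies below c + J / s. *)
Lemma pois_cut_lb n c J k : (0 < n)%N ->
  series (pois R) J * ((k%:R - m n) / s n <= c)%R%:R <= pois_cut n (c + J%:R / s n) k.
Proof.
move=> n0; have s0 := scale_gt0 R n0.
have sV : 0 < (s n)^-1 by rewrite invr_gt0.
apply: le_trans (sums_to_ge J _ (@pois_cutP n (c + J%:R / s n) k)); last first.
  by move=> j; rewrite mulr_ge0 ?(ltW (pois_gt0 _ _)).
rewrite /series /= mulr_suml [leLHS]big_nat [leRHS]big_nat.
apply: ler_sum => j /andP[_ jJ]; rewrite ler_wpM2l ?(ltW (pois_gt0 _ _))//.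
case: (leP ((k%:R - m n) / s n) c) => // kc.
suff -> : ((k + j)%:R - m n) / s n <= c + J%:R / s n by [].
by rewrite natrD addrAC mulrDl lerD// (ler_pM2r sV) ler_nat ltnW.
Qed.

Lemma pois_cut_cvg (c : nat -> R) (x : R) : c n @[n --> \oo] --> x ->
  wnorm R n * (\sum_(p : bnpart n) pois_cut n (c n) #|block_pairs p|)
    @[n --> \oo] --> normal_cdf x.
Proof.
move=> cx.
apply: (@laplace_sums R (fun n u => (u <= c n)%R%:R) (\1_(`]-oo, x] : set R)) x 1
  (normal_cdf x)).
- move=> n u; rewrite ler0n mul1r /=.
  by apply: (@le_trans _ _ 1); rewrite ?lern1 ?leq_b1// lerDl sqr_ge0.
- exact: measurable_indic.
- move=> y yx; have lc := @lattice_pt_cvg R y.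
  apply: cvg_near_cst; rewrite indicE.
  have [ltyx|ltxy|] := ltgtP y x; last by move/eqP; rewrite (negbTE yx).
  + rewrite mem_set /=; last by rewrite in_itv/= ltW.
    near=> n; rewrite (_ : (_ <= _) = true)//; apply: (@le_trans _ _ ((x + y) / 2)).
      by near: n; apply: cvgr_le lc _ _; lra.
    by near: n; apply: cvgr_ge cx _ _; lra.
  + rewrite memNset /=; last by rewrite in_itv/= leNgt ltxy.
    near=> n; rewrite leNgt (_ : (_ < _) = true)//.
    apply: (@lt_le_trans _ _ ((x + y) / 2)).
      by near: n; apply: cvgr_lt cx _ _; lra.
    by near: n; apply: cvgr_ge lc _ _; lra.
- exact: normal_cdfE.
move=> n; apply: mixture_sum => k; exact: pois_cutP.
Unshelve. all: by end_near. Qed.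

End Limit.

Section Final.
Variable R : realType.
Implicit Types (n j k : nat).
Local Notation M i := (pois_moment R i).
Local Notation s n := (scale R n).

Lemma cdf_count_ge0 n (c : R) : 0 <= cdf_count n c. Proof. by []. Qed.

Lemma cdf_count_le n (c : R) : cdf_count n c <= npart R n.
Proof. by rewrite ler_nat max_card. Qed.

Lemma wnorm_ge0 n : 0 <= wnorm R n.
Proof.
rewrite divr_ge0 ?normal_peak_ge0// mulr_ge0 ?(ltW (wt_gt0 _ _ _))//.
by rewrite invr_ge0 sqrtr_ge0.
Qed.

Lemma sum_pois_cut_ub n (c : R) : (0 < n)%N ->
  \sum_(p : bnpart n) pois_cut n c #|block_pairs p| <= M 0 * cdf_count n c.
Proof.
move=> n0; rewrite cdf_count_sum mulr_sumr; apply: ler_sum => p _.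
exact: pois_cut_ub.
Qed.

Lemma sum_pois_cut_lb n (c : R) J : (0 < n)%N ->
  series (pois R) J * cdf_count n c
  <= \sum_(p : bnpart n) pois_cut n (c + J%:R / s n) #|block_pairs p|.
Proof.
move=> n0; rewrite cdf_count_sum mulr_sumr; apply: ler_sum => p _.
exact: pois_cut_lb.
Qed.

(** The distribution function of xi_n at c n stands between that of xi_n + Z at c n
    and, up to the factor P(Z < J), that of xi_n + Z at c n + J / s. Both values have
    the limit normal_cdf x, and P(Z < J) is as close to 1 as desired. *)
Lemma cdf_count_cvg (c : nat -> R) (x : R) : c n @[n --> \oo] --> x ->
  cdf_count n (c n) / npart R n @[n --> \oo] --> normal_cdf x.
Proof.
move=> cx; apply/cvgrPdist_le => e e0; have M0 := pois_moment0_gt0 R.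
have e4 : 0 < e / 4 by rewrite divr_gt0.
have [J QJ] : exists J, (1 - e / 4) * M 0 <= series (pois R) J.
  have /cvgrPdist_le/(_ (e / 4 * M 0)) := @pois_sum R.
  rewrite mulr_gt0// => /(_ isT)[J _ hJ]; exists J.
  have := hJ J (leqnn _); rewrite ler_norml => /andP[_].
  by lra.
have cJ : c n + J%:R / s n @[n --> \oo] --> x.
  have h : c n + J%:R * (s n)^-1 @[n --> \oo] --> x + J%:R * 0.
    apply: cvgD => //; apply: cvgM; first exact: cvg_cst.
    exact: scaleV_cvg0.
  by rewrite mulr0 addr0 in h.
have l0 := pois_cut_cvg cx; have lJ := pois_cut_cvg cJ.
have lD := @wnorm_total R.
near=> n.
have n0 : (0 < n)%N by near: n; exact: nbhs_infty_gt.
have N0 := npart_gt0 R n.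
set f := cdf_count n (c n) / npart R n.
have f0 : 0 <= f by rewrite divr_ge0 ?(ltW N0)// cdf_count_ge0.
have f1 : f <= 1 by rewrite ler_pdivrMr// mul1r cdf_count_le.
have fE : cdf_count n (c n) = npart R n * f by rewrite mulrC divfK// gt_eqF.
have D1 : `|1 - wnorm R n * (npart R n * M 0)| <= e / 4.
  by near: n; move/cvgrPdist_le: lD => /(_ _ e4).
have D2 : wnorm R n * (npart R n * M 0) <= 2.
  by near: n; apply: cvgr_le lD _ _; lra.
set D := wnorm R n * (npart R n * M 0) in D1 D2.
have B0 : `|normal_cdf x - wnorm R n *
    (\sum_(p : bnpart n) pois_cut n (c n) #|block_pairs p|)| <= e / 4.
  by near: n; have /cvgrPdist_le/(_ _ e4) := l0.
have BJ : `|normal_cdf x - wnorm R n *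
    (\sum_(p : bnpart n) pois_cut n (c n + J%:R / s n) #|block_pairs p|)| <= e / 4.
  by near: n; have /cvgrPdist_le/(_ _ e4) := lJ.
have w0 := wnorm_ge0 n.
have := ler_wpM2l w0 (sum_pois_cut_ub (c n) n0).
have := ler_wpM2l w0 (sum_pois_cut_lb (c n) J n0).
rewrite fE.
have -> : wnorm R n * (M 0 * (npart R n * f)) = D * f by rewrite /D; ring.
have -> : wnorm R n * (series (pois R) J * (npart R n * f))
  = wnorm R n * npart R n * f * series (pois R) J by ring.
have h1 : wnorm R n * npart R n * f * ((1 - e / 4) * M 0)
    <= wnorm R n * npart R n * f * series (pois R) J.
  by apply: ler_wpM2l => //; apply: mulr_ge0 f0; apply: mulr_ge0 w0 (ltW N0).
have e1 : wnorm R n * npart R n * f * ((1 - e / 4) * M 0) = D * f * (1 - e / 4).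
  by rewrite /D; ring.
rewrite e1 in h1; move=> h2 h3.
have D0 : 0 <= D by apply: mulr_ge0 w0 _; apply: mulr_ge0; exact: ltW.
have h4 : D * f <= 2 by have := ler_pM D0 f0 D2 f1; rewrite mulr1.
have h5 : D * f * (e / 4) <= 2 * (e / 4) by rewrite ler_wpM2r// ltW.
have h6 : `|(1 - D) * f| <= e / 4.
  by rewrite normrM (ger0_norm f0) -[leRHS]mulr1 ler_pM.
move: B0 BJ h6; rewrite !ler_norml => /andP[b1 b2] /andP[b3 b4] /andP[b5 b6].
by clear - b1 b2 b3 b4 b5 b6 h1 h2 h3 h5; apply/andP; split; lra.
Unshelve. all: by end_near. Qed.

Lemma expectation_uniform n (f : bnpart n -> R) :
  ('E_(@uniform_bnpart R n)[f] = ((\sum_(p : bnpart n) f p) / npart R n)%:E)%E.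
Proof.
rewrite unlock.
have UE : [set: bnpart n] = \big[setU/set0]_(p <- enum {: bnpart n}) [set p].
  apply/seteqP; split=> // p _; rewrite -bigcup_seq; exists p => //=.
  by rewrite mem_enum.
rewrite UE integral_bigsetU_EFin//=; last 2 first.
- exact: enum_uniq.
- by move=> p q _ _ [r [/= -> ->]].
rewrite big_enum /= mulr_suml -sumEFin; apply: eq_bigr => p _.
transitivity (\int[@uniform_bnpart R n]_(x in [set p]) cst (f p)%:E x)%E.
  by apply: eq_integral => q; rewrite inE => ->.
rewrite integral_cst//= /uniform_bnpart -EFinM -/(npart R n).
suff -> : #|[pred q | q \in [set p]]| = 1%N by rewrite mul1r.
rewrite (@eq_card _ _ (pred1 p)) ?card1// => q; rewrite [LHS]inE /=.
by apply/idP/eqP => [|->]; rewrite inE.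
Qed.

Lemma mean_xi n : fine 'E_(@uniform_bnpart R n)[xi R n]%E = mean_pairs R n.
Proof. by rewrite expectation_uniform. Qed.

Lemma var_xi n : fine 'V_(@uniform_bnpart R n)[xi R n]%E = var_pairs R n.
Proof.
rewrite /variance unlock mean_xi expectation_uniform /=.
by congr (_ / _); exact: eq_bigr.
Qed.

Lemma cdf_xi n (x : R) :
  cdf (standardize (xi R n)) x =
  (#|[pred p : bnpart n | (#|block_pairs p|%:R - mean_pairs R n)
       / Num.sqrt (var_pairs R n) <= x]|%:R / npart R n)%:E.
Proof.
rewrite /cdf /distribution /pushforward /=.
rewrite -mean_xi -var_xi.
congr (_%:R / _)%:E; apply: eq_card => p.
rewrite !inE; apply/idP/idP => [|h]; first by rewrite inE /= in_itv.
by rewrite inE /= in_itv.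
Qed.

End Final.

Theorem theorem3p1 (R : realType) :
  cvg_in_distribution (fun n : nat => standardize (xi R n)) (normal_prob 0 1).
Proof.
move=> x _.
rewrite [X in _ --> X](_ : _ = (normal_cdf x)%:E); last first.
  by rewrite /normal_cdf fineK//; exact: fin_num_measure.
pose c n := qmean R n + x * (Num.sqrt (var_pairs R n) / scale R n).
have cx : c n @[n --> \oo] --> x.
  have h : c n @[n --> \oo] --> 0 + x * 1.
    apply: cvgD; first exact: qmean_cvg0.
    by apply: cvgM; [exact: cvg_cst|exact: sqrt_var_cvg].
  by rewrite add0r mulr1 in h.
have h : (cdf_count n (c n) / npart R n)%:E @[n --> \oo] --> (normal_cdf x)%:E.
  by apply: cvg_EFin; [exact: nearW|exact: cdf_count_cvg].
move: h; apply: cvg_trans; apply: near_eq_cvg; near=> n.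
have n0 : (0 < n)%N by near: n; exact: nbhs_infty_gt.
have s0 := scale_gt0 R n0.
have r0 : 0 < Num.sqrt (var_pairs R n) / scale R n.
  near: n; apply: cvgr_gt (@sqrt_var_cvg R) _ _; exact: ltr01.
have v0 : 0 < Num.sqrt (var_pairs R n) by move: r0; rewrite pmulr_lgt0// invr_gt0; exact.
rewrite cdf_xi; congr (_%:R / _)%:E; apply: eq_card => p; rewrite !inE.
rewrite ler_pdivrMr// [RHS]ler_pdivrMr//.
have -> : c n * scale R n = mean_pairs R n - (mode R n)%:R + x * Num.sqrt (var_pairs R n).
  by rewrite /c /qmean; field; rewrite gt_eqF.
by rewrite -[RHS]subr_ge0 -[LHS]subr_ge0; congr (0 <= _); ring.
Unshelve. all: by end_near. Qed.
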